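(* (i) For all $\varepsilon,\gamma>0$, $$\min\{C_E(\varepsilon,\gamma),C_R(\varepsilon,\gamma),A_E(\varepsilon,\gamma),A_R(\varepsilon,\gamma)\}\ge\frac{\Phi(1)-0.5}{\min\{1,\varepsilon\}}>\frac{0.3413}{\min\{1,\varepsilon\}}.$$ (ii) For $\frac12<p<1$, $q=1-p$, set $\Delta_1(p)=\Phi(\sqrt{q/p})-q$, and for $\gamma>0$ define: for $\varepsilon\le1$, $$K_{E,0}(p,\varepsilon,\gamma)=\begin{cases}\Delta_1(p)/\varepsilon,&\frac12<p\le\frac1{\varepsilon^2+1},\\ \Delta_1(p)\big/\max\{\sqrt{q/p},\gamma\sqrt{q^3/p}+\varepsilon p\},&\frac1{\varepsilon^2+1}<p<1,\end{cases}$$ $$K_{R,0}(p,\varepsilon,\gamma)=\begin{cases}\Delta_1(p)/\varepsilon,&\frac12<p\le\frac1{\varepsilon^2+1},\\ \Delta_1(p)\big/\big(\gamma\sqrt{q^3/p}+\max\{\sqrt{q/p},\varepsilon p\}\big),&\frac1{\varepsilon^2+1}<p<1,\end{cases}$$ and for $\varepsilon>1$: $K_{E,0}(p,\varepsilon,\gamma)=\Delta_1(p)/\max\{\sqrt{q/p},\gamma\sqrt{q^3/p}+p\}$ for $\frac12<p<1$, $$K_{E,*}(p,\varepsilon,\gamma)=\begin{cases}\Delta_1(p)\big/\max\{\sqrt{q/p},\gamma\sqrt{q^3/p}+\varepsilon p\},&\frac{\varepsilon^2}{\varepsilon^2+1}\le p<1,\\ \Delta_1(p)\sqrt{pq}\big/\max\{q,\gamma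 q^2+p^2,\gamma(p-q)\},&\frac12<p<\frac{\varepsilon^2}{\varepsilon^2+1},\end{cases}$$ $$K_{R,0}(p,\varepsilon,\gamma)=\begin{cases}\Delta_1(p)\big/\big(\frac\gamma\varepsilon\sqrt{q^3/p}+\max\{\sqrt{q/p},p\}\big),&\frac{\varepsilon^2}{\varepsilon^2+1}\le p<1,\\ \Delta_1(p)\big/\big(\frac{\gamma(p-q)}{\varepsilon\sqrt{pq}}+\max\{\sqrt{q/p},p\}\big),&\frac12<p<\frac{\varepsilon^2}{\varepsilon^2+1},\end{cases}$$ $$K_{R,*}(p,\varepsilon,\gamma)=\begin{cases}\Delta_1(p)\big/\big(\gamma\sqrt{q^3/p}+\max\{\sqrt{q/p},\varepsilon p\}\big),&\frac{\varepsilon^2}{\varepsilon^2+1}\le p<1,\\ \Delta_1(p)\big/\big(\frac{\gamma(p-q)}{\sqrt{pq}}+\max\{\sqrt{q/p},\sqrt{p^3/q}\}\big),&\frac12<p<\frac{\varepsilon^2}{\varepsilon^2+1}.\end{cases}$$ Then for all $\varepsilon,\gamma>0$: $C_E(\varepsilon,\gamma)\ge\sup_{\frac12<p<1}K_{E,0}(p,\varepsilon,\gamma)$ and $C_R(\varepsilon,\gamma)\ge\sup_{\frac12<p<1}K_{R,0}(p,\varepsilon,\gamma)$; and for $\varepsilon>1$ also $A_E(\varepsilon,\gamma)\ge\sup_{\frac12<p<1}K_{E,*}(p,\varepsilon,\gamma)$ and $A_R(\varepsilon,\gamma)\ge\sup_{\frac12<p<1}K_{R,*}(p,\varepsilon,\gamma)$.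 In particular, $$A_E(\infty,1)\ge\sup_{\frac12<p<1}\frac{(\Phi(\sqrt{q/p})-q)\sqrt{pq}}{q^2+p^2}>0.3703,$$ and $$\min\{C_E(1,1),C_R(1,1),C_E(\infty,1)\}\ge\sup_{\frac12<p<1}\frac{\Phi(\sqrt{q/p})-q}{\sqrt{q^3/p}+p}>0.5685$$ (the supremum being attained at $p=0.9058\ldots$).
   Context: $\Phi$ is the standard normal distribution function. For independent random variables $X_1,\dots,X_n$ with distribution functions $F_k(x)={\sf P}(X_k<x)$, ${\sf E}X_k=0$, $\sigma_k^2={\sf E}X_k^2<\infty$, $B_n^2=\sum_k\sigma_k^2>0$, $S_n=X_1+\dots+X_n$, let $\Delta_n(F_1,\dots,F_n)=\sup_x|{\sf P}(S_n/B_n<x)-\Phi(x)|$, $\mu_k(z)={\sf E}X_k^3\mathbf 1(|X_k|<z)$, $\sigma_k^2(z)={\sf E}X_k^2\mathbf 1(|X_k|\ge z)$, $M_n(z)=B_n^{-3}\sum_k\mu_k(zB_n)$, $L_n(z)=B_n^{-2}\sum_k\sigma_k^2(zB_n)$. Let $\mathcal G$ be the set of non-decreasing $g:[0,\infty)\to[0,\infty)$ with $g(z)>0$ for $z>0$ and $z/g(z)$ non-decreasing on $(0,\infty)$. For $g\in\mathcal G$, $\varepsilon,\gamma>0$: $L_{E,n}(g,\varepsilon,\gamma)=\sup_{0<z<\varepsilon}\frac{g(zB_n)}{zg(B_n)}(\gamma|M_n(z)|+zL_n(z))$, $L_{R,n}(g,\varepsilon,\gamma)=\gamma\frac{g(\varepsilon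 B_n)}{\varepsilon g(B_n)}|M_n(\varepsilon)|+\sup_{0<z<\varepsilon}\frac{g(zB_n)}{g(B_n)}L_n(z)$; values at $\varepsilon=\infty$ are limits as $\varepsilon\to\infty$. Let $\mathcal F$ be the set of distribution functions with zero mean and finite second moment. Define $C_E(g,\varepsilon,\gamma)=\sup\Delta_n(F_1,\dots,F_n)/L_{E,n}(g,\varepsilon,\gamma)$ and $C_R(g,\varepsilon,\gamma)=\sup\Delta_n(F_1,\dots,F_n)/L_{R,n}(g,\varepsilon,\gamma)$, the suprema over all $n\in\mathbb N$ and $F_1,\dots,F_n\in\mathcal F$ with $B_n>0$; the exact constants are $C_E(\varepsilon,\gamma)=\sup_{g\in\mathcal G}C_E(g,\varepsilon,\gamma)$, $C_R(\varepsilon,\gamma)=\sup_{g\in\mathcal G}C_R(g,\varepsilon,\gamma)$, and $A_E(\varepsilon,\gamma)=C_E(g_*,\varepsilon,\gamma)$, $A_R(\varepsilon,\gamma)=C_R(g_*,\varepsilon,\gamma)$ with $g_*(z)=z$. *)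

(* Defs.v *)
From HB Require Import structures.
From mathcomp Require Import all_boot all_order all_algebra.
From mathcomp Require Import all_classical all_reals all_analysis.
From mathcomp Require Import normal_distribution.
Set Implicit Arguments. Unset Strict Implicit. Unset Printing Implicit Defensive.
Import Order.TTheory GRing.Theory Num.Theory.
Local Open Scope classical_set_scope.
Local Open Scope ring_scope.

Section defs.
Variable R : realType.

Definition Phi (x : R) : R := fine (normal_prob 0 1 `]-oo, x[).

Section instance.
Context {d : measure_display} {T : measurableType d} (P : probability T R)
        (n : nat) (X : 'I_n -> {RV P >-> R}).

Definition mutually_independent : Prop :=
  forall A : 'I_n -> set R, (forall i, measurable (A i)) ->
    P [set w | forall i, A i (X i w)] = (\prod_(i < n) P (X i @^-1` A i))%E.

Definition admissible : Prop :=
  mutually_independent /\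
  (forall k, P.-integrable setT (EFin \o X k)) /\
  (forall k, P.-integrable setT (EFin \o (fun w => X k w ^+ 2))) /\
  (forall k, (expectation P (X k)) = 0%E) /\
  0 < \sum_(k < n) fine (expectation P (fun w => X k w ^+ 2)).

Definition Bn : R := Num.sqrt (\sum_(k < n) fine (expectation P (fun w => X k w ^+ 2))).
Definition Sn (w : T) : R := \sum_(k < n) X k w.

Definition Deltan : R :=
  sup [set `|fine (P [set w | Sn w / Bn < x]) - Phi x| | x in [set: R]].

Definition mu_k (k : 'I_n) (z : R) : R :=
  fine (expectation P (fun w => if `|X k w| < z then X k w ^+ 3 else 0)).
Definition sigma2_k (k : 'I_n) (z : R) : R :=
  fine (expectation P (fun w => if z <= `|X k w| then X k w ^+ 2 else 0)).

Definition Mn (z : R) : R := Bn ^- 3 * \sum_(k < n) mu_k k (z * Bn).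
Definition Ln (z : R) : R := Bn ^- 2 * \sum_(k < n) sigma2_k k (z * Bn).

(* eps in (0, +oo]; at eps = +oo the sup is over all z > 0,
   which is the (monotone) limit as eps -> oo *)
Definition L_E (g : R -> R) (eps : \bar R) (gam : R) : \bar R :=
  ereal_sup [set ((g (z * Bn) / (z * g Bn)) * (gam * `|Mn z| + z * Ln z))%:E
            | z in [set z | 0 < z /\ (z%:E < eps)%E]].

Definition L_R (g : R -> R) (eps : R) (gam : R) : \bar R :=
  ((gam * (g (eps * Bn) / (eps * g Bn)) * `|Mn eps|)%:E +
   ereal_sup [set (g (z * Bn) / g Bn * Ln z)%:E | z in [set z : R | (0 < z < eps)%R]])%E.

End instance.

Definition in_G (g : R -> R) : Prop :=
  (forall x y, 0 <= x -> x <= y -> g x <= g y) /\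
  (forall x, 0 <= x -> 0 <= g x) /\
  (forall z, 0 < z -> 0 < g z) /\
  (forall x y, 0 < x -> x <= y -> x / g x <= y / g y).

Definition C_E_g (g : R -> R) (eps : \bar R) (gam : R) : \bar R :=
  ereal_sup [set r | exists (d : measure_display) (T : measurableType d)
     (P : probability T R) (n : nat) (X : 'I_n -> {RV P >-> R}),
     admissible X /\ L_E X g eps gam \is a fin_num /\
     r = (Deltan X / fine (L_E X g eps gam))%:E].

Definition C_R_g (g : R -> R) (eps : R) (gam : R) : \bar R :=
  ereal_sup [set r | exists (d : measure_display) (T : measurableType d)
     (P : probability T R) (n : nat) (X : 'I_n -> {RV P >-> R}),
     admissible X /\ L_R X g eps gam \is a fin_num /\
     r = (Deltan X / fine (L_R X g eps gam))%:E].

Definition C_E (eps : \bar R) (gam : R) : \bar R :=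
  ereal_sup [set C_E_g g eps gam | g in in_G].
Definition C_R (eps : R) (gam : R) : \bar R :=
  ereal_sup [set C_R_g g eps gam | g in in_G].
Definition A_E (eps : \bar R) (gam : R) : \bar R := C_E_g id eps gam.
Definition A_R (eps : R) (gam : R) : \bar R := C_R_g id eps gam.

Definition Delta1 (p : R) : R := Phi (Num.sqrt ((1 - p) / p)) - (1 - p).

Definition K_E0 (eps gam p : R) : R :=
  let q := 1 - p in
  if eps <= 1 then
    if p <= 1 / (eps ^+ 2 + 1) then Delta1 p / eps
    else Delta1 p / Num.max (Num.sqrt (q / p)) (gam * Num.sqrt (q ^+ 3 / p) + eps * p)
  else Delta1 p / Num.max (Num.sqrt (q / p)) (gam * Num.sqrt (q ^+ 3 / p) + p).

Definition K_R0 (eps gam p : R) : R :=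
  let q := 1 - p in
  if eps <= 1 then
    if p <= 1 / (eps ^+ 2 + 1) then Delta1 p / eps
    else Delta1 p / (gam * Num.sqrt (q ^+ 3 / p) + Num.max (Num.sqrt (q / p)) (eps * p))
  else
    if eps ^+ 2 / (eps ^+ 2 + 1) <= p then
      Delta1 p / (gam / eps * Num.sqrt (q ^+ 3 / p) + Num.max (Num.sqrt (q / p)) p)
    else
      Delta1 p / (gam * (p - q) / (eps * Num.sqrt (p * q)) + Num.max (Num.sqrt (q / p)) p).

(* used only for eps > 1 *)
Definition K_Estar (eps gam p : R) : R :=
  let q := 1 - p in
  if eps ^+ 2 / (eps ^+ 2 + 1) <= p then
    Delta1 p / Num.max (Num.sqrt (q / p)) (gam * Num.sqrt (q ^+ 3 / p) + eps * p)
  else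
    Delta1 p * Num.sqrt (p * q) /
      Num.max q (Num.max (gam * q ^+ 2 + p ^+ 2) (gam * (p - q))).

Definition K_Rstar (eps gam p : R) : R :=
  let q := 1 - p in
  if eps ^+ 2 / (eps ^+ 2 + 1) <= p then
    Delta1 p / (gam * Num.sqrt (q ^+ 3 / p) + Num.max (Num.sqrt (q / p)) (eps * p))
  else
    Delta1 p / (gam * (p - q) / Num.sqrt (p * q) +
                Num.max (Num.sqrt (q / p)) (Num.sqrt (p ^+ 3 / q))).

Definition sup_half (K : R -> R) : \bar R :=
  ereal_sup [set (K p)%:E | p in [set p | 2^-1 < p < 1]].

End defs.

(* Main.v *)
Require Import Defs.
From HB Require Import structures.
From mathcomp Require Import all_boot all_order all_algebra.
From mathcomp Require Import all_classical all_reals all_analysis.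
From mathcomp Require Import measurable_realfun normal_distribution ring lra.
Set Implicit Arguments. Unset Strict Implicit. Unset Printing Implicit Defensive.
Import Order.TTheory GRing.Theory Num.Theory.
Import numFieldNormedType.Exports.
Local Open Scope classical_set_scope.
Local Open Scope ring_scope.

(** All lower bounds but one come from a single summand with two values: put
    t = sqrt (q / p) and let X be t with probability p and -1/t with probability
    q. Then the truncated moments are step functions with jumps at t and 1/t, and
    the left limit at t of the distribution function misses Phi t by Delta1 p. The
    weight g = id gives the bounds on A_E and A_R, and g = min(., 1) those on C_E
    and C_R for eps > 1.

    The exception is C_E for eps > 1 and gam > 1. There the large value of
    |M_n(z)| beyond z = 1/t adds gam (p - q) / p to the maximum, an entry that
    the denominator of K_{E,0} lacks and that may dominate. Instead, five
    independent summands are used: X_1, - X_1', X_2, - X_2' with X_i' distributed as X_i,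
    where X_1 is 4 or -7 and X_2 is 5 or -6 (in units of 5/66), and a symmetric
    rare large jump carrying variance 364/1089. Then M_n vanishes identically, so
    gam is irrelevant, while the lattice sum has mass about 5645/14641 at 0, so
    that the ratio exceeds 0.576, whereas sup_p K_{E,0}(p, eps, gam) < 0.569.

    The quotient of the last display is a function of t whose derivative has the
    sign of a decreasing function; that function changes sign between 39/121 and
    69/214, which localises the maximiser. *)

(** * Products of finite laws *)

Section finite_product.
Variables (R : realType) (n k : nat).

Record law := Law {
  weight :> 'I_k.+1 -> R;
  weight_ge0 : forall j, 0 <= weight j;
  weight_sum : \sum_j weight j = 1 }.

(** The sample space carries the discrete sigma-algebra, so that every function on it is
    measurable. *)
Definition outcome : Type := {ffun 'I_n -> 'I_k.+1}.
HB.instance Definition _ := Finite.on outcome.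
HB.instance Definition _ := isPointed.Build outcome [ffun=> ord0].
HB.instance Definition _ := @isMeasurable.Build default_measure_display
  outcome discrete_measurable discrete_measurable0
  discrete_measurableC discrete_measurableU.

Variable F : 'I_n -> law.

Definition point_mass (w : outcome) : R := \prod_i F i (w i).

Lemma point_mass_ge0 w : 0 <= point_mass w.
Proof. by apply: prodr_ge0 => i _; exact: weight_ge0. Qed.

(** A finite sum of weighted Dirac masses is a measure by construction, and integrals against it
    reduce to finite sums. *)
Definition product_law : set outcome -> \bar R :=
  msum (fun i => mscale (NngNum (point_mass_ge0 (nth point (enum {: outcome}) i)))
                        \d_(nth point (enum {: outcome}) i)) #|{: outcome}|.

HB.instance Definition _ := Measure.on product_law.

Lemma sum_product (h : 'I_n -> 'I_k.+1 -> R) :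
  \sum_(w : outcome) \prod_i h i (w i) = \prod_i \sum_j h i j.
Proof. by rewrite bigA_distr_bigA. Qed.

Lemma sum_enum (f : outcome -> R) :
  \sum_(i < #|{: outcome}|) f (nth point (enum {: outcome}) i) = \sum_w f w.
Proof.
by rewrite -[RHS](big_enum _ _ xpredT) (big_nth point) -cardE big_mkord.
Qed.

Lemma product_lawE A : product_law A = (\sum_w point_mass w * \1_A w)%:E.
Proof.
rewrite /product_law /msum -(sum_enum (fun w => point_mass w * \1_A w)).
by rewrite sumEFin.
Qed.

Lemma product_law_setT : product_law setT = 1%E.
Proof.
rewrite product_lawE; congr EFin.
under eq_bigr do rewrite indicT mulr1.
rewrite (sum_product (fun i j => F i j)) big1// => i _.
exact: weight_sum.
Qed.

HB.instance Definition _ :=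
  @Measure_isProbability.Build _ _ R product_law product_law_setT.

Lemma outcome_measurable_fun d (T : measurableType d) (f : outcome -> T) :
  measurable_fun setT f.
Proof. by []. Qed.

Lemma ge0_integral_product_law (f : outcome -> R) : (forall w, 0 <= f w) ->
  (\int[product_law]_w (f w)%:E)%E = (\sum_w point_mass w * f w)%:E.
Proof.
move=> f0; rewrite /product_law ge0_integral_measure_sum//=; last first.
  by move=> w _; rewrite lee_fin.
rewrite -(sum_enum (fun w => point_mass w * f w)) -sumEFin.
apply: eq_bigr => i _; rewrite ge0_integral_mscale//=; last first.
  by move=> w _; rewrite lee_fin.
by rewrite integral_dirac//= diracT mul1e.
Qed.

Lemma integrable_product_law (f : outcome -> R) :
  product_law.-integrable setT (EFin \o f).
Proof.
apply/integrableP; split; first by [].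
by rewrite /= ge0_integral_product_law ?ltry.
Qed.

Lemma integral_product_law (f : outcome -> R) :
  (\int[product_law]_w (f w)%:E)%E = (\sum_w point_mass w * f w)%:E.
Proof.
(* A difference of two non-negative functions, to each of which the non-negative case applies. *)
have Ef w : f w = (f w + `|f w|) - `|f w| by rewrite addrK.
under eq_integral do rewrite Ef EFinB.
rewrite integralB_EFin//; [|exact: integrable_product_law..].
rewrite !ge0_integral_product_law//; last first.
  by move=> w; rewrite -lerBlDr sub0r lerNnormlW.
rewrite -EFinB -sumrB; congr EFin; apply: eq_bigr => w _.
by rewrite -mulrBr -Ef.
Qed.

(** Marginalisation: the sum factorises over the coordinates, and every factor other than the [i]-th
    is a total mass 1. *)
Lemma sum_coordinate (i : 'I_n) (f : 'I_k.+1 -> R) :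
  \sum_(w : outcome) point_mass w * f (w i) = \sum_j F i j * f j.
Proof.
pose h i' j := F i' j * (if i' == i then f j else 1).
transitivity (\sum_(w : outcome) \prod_i' h i' (w i')).
  apply: eq_bigr => w _; rewrite big_split /=; congr (_ * _).
  by rewrite -big_mkcond big_pred1_eq.
rewrite sum_product (bigD1 i)//= [X in _ * X]big1 ?mulr1; last first.
  move=> i' /negbTE i'i; rewrite /h i'i.
  by under eq_bigr do rewrite mulr1; exact: weight_sum.
by apply: eq_bigr => j _; rewrite /h eqxx.
Qed.

Variable x : 'I_n -> 'I_k.+1 -> R.

Definition coordinate (i : 'I_n) (w : outcome) : R := x i (w i).

HB.instance Definition _ i := isMeasurableFun.Build _ _ _ _ (coordinate i)
  (outcome_measurable_fun (coordinate i)).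

Definition X (i : 'I_n) : {RV product_law >-> R} := coordinate i.

Lemma expectation_X i (f : R -> R) :
  expectation product_law (fun w => f (X i w)) = (\sum_j F i j * f (x i j))%:E.
Proof.
by rewrite unlock integral_product_law (sum_coordinate i (fun j => f (x i j))).
Qed.

Lemma mutually_independent_X : mutually_independent X.
Proof.
move=> A mA.
transitivity (\prod_(i < n) (\sum_j F i j * \1_(A i) (x i j)))%:E; last first.
  rewrite -prodEFin; apply: eq_bigr => i _.
  by rewrite [RHS]product_lawE -(sum_coordinate i (fun j => \1_(A i) (x i j))).
rewrite [LHS]product_lawE -sum_product; congr EFin; apply: eq_bigr => w _.
rewrite big_split /=; congr (_ * _).
(* The indicator of the intersection is the product of the indicators. *)
rewrite indicE; have [/set_mem/= Aw|/negP Aw] := boolP (w \in _).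
  by rewrite big1// => i _; rewrite indicE mem_set//; exact: Aw.
have /existsNP[i Ai] : ~ forall i, A i (X i w) by move=> h; apply/Aw/mem_set.
by rewrite (bigD1 i)//= indicE memNset ?mul0r.
Qed.

Hypothesis x_mean0 : forall i, \sum_j F i j * x i j = 0.
Hypothesis x_var1 : \sum_i \sum_j F i j * x i j ^+ 2 = 1.

Lemma sum_variance_X :
  \sum_(i < n) fine (expectation product_law (fun w => X i w ^+ 2)) = 1.
Proof.
by rewrite -[RHS]x_var1; apply: eq_bigr => i _; rewrite (expectation_X i (fun y => y ^+ 2)).
Qed.

Lemma admissible_X : admissible X.
Proof.
split; first exact: mutually_independent_X.
split; first by move=> i; exact: integrable_product_law.
split; first by move=> i; exact: integrable_product_law.
split; last by rewrite sum_variance_X ltr01.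
by move=> i; rewrite (expectation_X i id) x_mean0.
Qed.

Lemma Bn_X : Bn X = 1. Proof. by rewrite /Bn sum_variance_X sqrtr1. Qed.

Lemma Mn_X z :
  Mn X z = \sum_i \sum_j F i j * (if `|x i j| < z then x i j ^+ 3 else 0).
Proof.
rewrite /Mn Bn_X expr1n invr1 mul1r mulr1; apply: eq_bigr => i _.
by rewrite /mu_k (expectation_X i (fun y => if `|y| < z then y ^+ 3 else 0)).
Qed.

Lemma Ln_X z :
  Ln X z = \sum_i \sum_j F i j * (if z <= `|x i j| then x i j ^+ 2 else 0).
Proof.
rewrite /Ln Bn_X expr1n invr1 mul1r mulr1; apply: eq_bigr => i _.
by rewrite /sigma2_k (expectation_X i (fun y => if z <= `|y| then y ^+ 2 else 0)).
Qed.

Lemma Ln_X_ge0 z : 0 <= Ln X z.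
Proof.
rewrite Ln_X; apply: sumr_ge0 => i _; apply: sumr_ge0 => j _.
by rewrite mulr_ge0 ?weight_ge0//; case: ifP => // _; exact: sqr_ge0.
Qed.

(** Total variance 1 forces an atom with positive second moment, and it counts in [Ln] at every
    level up to its modulus. This keeps [L_E] and [L_R] positive. *)
Lemma Ln_X_gt0 (e : R) : 0 < e -> exists z, [/\ 0 < z, z < e & 0 < Ln X z].
Proof.
move=> e0.
have term_ge0 i j : 0 <= F i j * x i j ^+ 2 by rewrite mulr_ge0 ?weight_ge0 ?sqr_ge0.
have [i [j Fx0]] : exists i j, 0 < F i j * x i j ^+ 2.
  apply/not_existsP => h; have := oner_eq0 R; rewrite -x_var1 big1 ?eqxx// => i _.
  rewrite big1// => j _; apply/eqP; rewrite eq_le term_ge0 andbT leNgt.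
  by apply/negP => ?; apply: (h i); exists j.
have xij0 : x i j != 0 by apply: contraTneq Fx0 => ->; rewrite expr0n mulr0 ltxx.
exists (Num.min `|x i j| (e / 2)); split.
- by rewrite lt_min normr_gt0 xij0 divr_gt0.
- by rewrite gt_min orbC ltr_pdivrMr// ltr_pMr// ltr1n.
- rewrite Ln_X (bigD1 i)//= (bigD1 j)//= ge_min lexx/= -addrA ltr_wpDr//.
  rewrite addr_ge0//; last (apply: sumr_ge0 => i' _); apply: sumr_ge0 => j' _;
    by rewrite mulr_ge0 ?weight_ge0//; case: ifP => // _; exact: sqr_ge0.
Qed.

End finite_product.

(** * Lower bounds for the uniform distance to the normal law *)

Section deviation.
Variables (R : realType) (d : measure_display) (T : measurableType d).
Variables (P : probability T R) (n : nat) (X : 'I_n -> {RV P >-> R}).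

Lemma fine_prob_ge0_le1 d' (T' : measurableType d') (Q : probability T' R) A :
  measurable A -> 0 <= fine (Q A) <= 1.
Proof.
move=> mA; rewrite fine_ge0//= -lee_fin fineK ?probability_le1//.
exact: fin_num_measure.
Qed.

Lemma Phi_ge0_le1 (y : R) : 0 <= Phi y <= 1.
Proof. exact: fine_prob_ge0_le1. Qed.

Let measurable_ratio : measurable_fun setT (fun w => Sn X w / Bn X).
Proof.
apply: measurable_funM => //; apply: measurable_sum => i.
exact: measurable_funPT.
Qed.

Lemma measurable_Sn_lt y : measurable [set w | Sn X w / Bn X < y].
Proof.
rewrite (_ : [set _ | _] = setT `&` (fun w => Sn X w / Bn X) @^-1` `]-oo, y[).
  exact: measurable_ratio.
by rewrite setTI; apply/seteqP; split => w /=; rewrite in_itv.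
Qed.

Lemma measurable_Sn_eq y : measurable [set w | Sn X w / Bn X = y].
Proof.
rewrite (_ : [set _ | _] = setT `&` (fun w => Sn X w / Bn X) @^-1` [set y]).
  exact: measurable_ratio.
by rewrite setTI.
Qed.

Lemma Deltan_ge y :
  `|fine (P [set w | Sn X w / Bn X < y]) - Phi y| <= Deltan X.
Proof.
apply: ub_le_sup; last by exists y.
(* The real [sup] dominates the members of a set bounded above; here two probabilities differ by at
   most 1. *)
exists 1 => _ [z _ <-].
have /andP[P0 P1] := fine_prob_ge0_le1 P (measurable_Sn_lt z).
have /andP[Q0 Q1] := Phi_ge0_le1 z.
by rewrite ler_norml; apply/andP; split; lra.
Qed.

Lemma Deltan_ge0 : 0 <= Deltan X.
Proof. exact: le_trans (normr_ge0 _) (Deltan_ge 0). Qed.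

(* The two one-sided limits at 0 of the distribution function of the normalised
   sum differ by the mass at 0, whereas Phi is continuous there. *)
Lemma Deltan_ge_jump (c : R) :
  (forall y, 0 <= y -> Phi y - Phi 0 <= c * y) ->
  fine (P [set w | Sn X w / Bn X = 0]) / 2 <= Deltan X.
Proof.
move=> Phi_lip; apply/ler_addgt0Pr => e e0.
have c0 : 0 < `|c| + 1 by rewrite ltr_pwDr.
(* The denominator is positive for [c] of either sign, and [c * y <= e]. *)
pose y := e / (`|c| + 1).
have y0 : 0 < y by rewrite divr_gt0.
have cy : c * y <= e.
  rewrite /y mulrCA ler_piMr// ?(ltW e0)// ler_pdivrMr// mul1r.
  by rewrite (le_trans (ler_norm _))// lerDl.
have m0 := measurable_Sn_eq 0.
have incl : [set w | Sn X w / Bn X < 0] `|` [set w | Sn X w / Bn X = 0]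
    `<=` [set w | Sn X w / Bn X < y].
  by move=> w [/= /lt_trans ->//|/= ->].
have := le_measure P _ _ incl; rewrite !inE => /(_ _ (measurable_Sn_lt y)).
move=> /(_ (measurableU _ _ (measurable_Sn_lt 0) m0)).
rewrite measureU//; [|exact: measurable_Sn_lt|]; last first.
  by apply/seteqP; split => // w [/= + E]; rewrite E ltxx.
rewrite -[X in (X + _)%E]fineK ?fin_num_measure//; last exact: measurable_Sn_lt.
rewrite -[X in (_ + X)%E]fineK ?fin_num_measure//.
rewrite -[leRHS]fineK ?fin_num_measure//; last exact: measurable_Sn_lt.
rewrite -EFinD lee_fin => le_jump.
have := Deltan_ge 0; have := Deltan_ge y; rewrite !ler_norml => /andP[_ Dy] /andP[D0 _].
have := Phi_lip _ (ltW y0); lra.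
Qed.

End deviation.

(** * From upper bounds on the fractions to lower bounds on the constants *)

Section extremal_ratio.
Variables (R : realType) (d : measure_display) (T : measurableType d).
Variables (P : probability T R) (n : nat) (X : 'I_n -> {RV P >-> R}).
Variables (g : R -> R) (gam : R).
Hypotheses (X_adm : admissible X) (B1 : Bn X = 1) (g_G : in_G g) (g1 : g 1 = 1).
Hypothesis gam0 : 0 < gam.
Hypothesis L_gt0 : forall e : R, 0 < e -> exists z, [/\ 0 < z, z < e & 0 < Ln X z].

(** One instance bounds the constant from below by [Deltan X / L_E], and enlarging [L_E] to [D] only
    decreases this. With [Bn X = 1] and [g 1 = 1] the weight is just [g z / z]. *)
Lemma ratio_le_C_E_g (eps : \bar R) (D : R) : (0 < eps)%E -> 0 < D ->
  (forall z, 0 < z -> (z%:E < eps)%E ->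
     g z / z * (gam * `|Mn X z| + z * Ln X z) <= D) ->
  ((Deltan X / D)%:E <= C_E_g g eps gam)%E.
Proof.
move=> eps0 D0 ubD; case: g_G => _ [_ [g_gt0 _]].
pose V := L_E X g eps gam.
have leVD : (V <= D%:E)%E.
  apply: ge_ereal_sup => _ [z [z0 zeps] <-].
  by rewrite lee_fin B1 g1 !mulr1 ubD.
(* At [V = 0] the inverse would take the default value 0 and the comparison with [D] could fail. *)
have V0 : (0 < V)%E.
  have [e e0 eeps] : exists2 e : R, 0 < e & (e%:E <= eps)%E.
    move: eps0; case: (eps) => [r|_|]//=; last by exists 1; rewrite ?leey.
    by rewrite lte_fin => r0; exists r.
  have [z [z0 ze Lz]] := L_gt0 e0.
  apply: (@lt_le_trans _ _ (g z / z * (gam * `|Mn X z| + z * Ln X z))%:E).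
    rewrite lte_fin mulr_gt0// ?divr_gt0// ?g_gt0//.
    by apply: ltr_wpDl; [rewrite mulr_ge0// ltW|rewrite mulr_gt0].
  apply: ereal_sup_ubound; exists z; last by rewrite B1 g1 !mulr1.
  by split => //; rewrite (lt_le_trans _ eeps)// lte_fin.
have Vfin : V \is a fin_num by rewrite ge0_fin_numE ?(ltW V0)// (le_lt_trans leVD) ?ltry.
apply: (@le_trans _ _ (Deltan X / fine V)%:E); last first.
  by apply: ereal_sup_ubound; exists d, T, P, n, X.
rewrite lee_fin ler_wpM2l ?Deltan_ge0// lef_pV2 ?posrE//.
  by rewrite -lee_fin fineK.
by rewrite -lte_fin fineK.
Qed.

(** The fraction is a sum here, so its two terms are bounded separately. *)
Lemma ratio_le_C_R_g (eps D1 D2 : R) : 0 < eps -> 0 < D1 + D2 ->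
  gam * (g eps / eps) * `|Mn X eps| <= D1 ->
  (forall z, 0 < z -> z < eps -> g z * Ln X z <= D2) ->
  ((Deltan X / (D1 + D2))%:E <= C_R_g g eps gam)%E.
Proof.
move=> eps0 D0 ubD1 ubD2; case: g_G => _ [_ [g_gt0 _]].
pose V := L_R X g eps gam.
have leVD : (V <= (D1 + D2)%:E)%E.
  rewrite EFinD; apply: leeD; first by rewrite lee_fin B1 g1 !mulr1.
  apply: ge_ereal_sup => _ [z /andP[z0 zeps] <-].
  by rewrite lee_fin B1 g1 mulr1 divr1 ubD2.
have V0 : (0 < V)%E.
  have [z [z0 ze Lz]] := L_gt0 eps0.
  apply: (@lt_le_trans _ _ (g z * Ln X z)%:E).
    by rewrite lte_fin mulr_gt0// g_gt0.
  rewrite -[leLHS]add0e; apply: leeD.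
    rewrite lee_fin B1 g1 !mulr1 mulr_ge0// mulr_ge0 ?(ltW gam0)//.
    by rewrite divr_ge0// ltW// g_gt0.
  apply: ereal_sup_ubound; exists z; first by rewrite /= z0.
  by rewrite B1 g1 mulr1 divr1.
have Vfin : V \is a fin_num by rewrite ge0_fin_numE ?(ltW V0)// (le_lt_trans leVD) ?ltry.
apply: (@le_trans _ _ (Deltan X / fine V)%:E); last first.
  by apply: ereal_sup_ubound; exists d, T, P, n, X.
rewrite lee_fin ler_wpM2l ?Deltan_ge0// lef_pV2 ?posrE//.
  by rewrite -lee_fin fineK.
by rewrite -lte_fin fineK.
Qed.

End extremal_ratio.

(** * Two weight functions in the class G *)

Section weight_functions.
Variable R : realType.

Lemma in_G_id : in_G (@id R).
Proof.
split; first by [].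
split; first by [].
split; first by [].
move=> x y x0 xy /=; rewrite !divff// gt_eqF//.
exact: lt_le_trans xy.
Qed.

(** Capping at 1 replaces [z * Ln z] by [Ln z] beyond [z = 1], so that an atom at a large value
    costs only its variance. *)
Lemma in_G_min1 : in_G (fun z : R => Num.min z 1).
Proof.
split; first by move=> x y _ xy; rewrite le_min !ge_min xy lexx orbT.
split; first by move=> x x0; rewrite le_min x0 ler01.
split; first by move=> z z0; rewrite lt_min z0 ltr01.
move=> x y x0 xy; have y0 := lt_le_trans x0 xy.
have [x1|x1] := leP x 1; have [y1|y1] := leP y 1.
- by rewrite !divff ?gt_eqF.
- by rewrite divff ?gt_eqF// divr1 ltW.
- by have := le_lt_trans (le_trans xy y1) x1; rewrite ltxx.
- by rewrite !divr1.
Qed.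

Lemma A_E_le_C_E (eps : \bar R) gam : (A_E eps gam <= C_E eps gam)%E.
Proof. by apply: ereal_sup_ubound; exists id => //; exact: in_G_id. Qed.

Lemma A_R_le_C_R (eps : R) gam : (A_R eps gam <= C_R eps gam)%E.
Proof. by apply: ereal_sup_ubound; exists id => //; exact: in_G_id. Qed.

Lemma C_E_g_le_C_E g (eps : \bar R) gam : in_G g -> (C_E_g g eps gam <= C_E eps gam)%E.
Proof. by move=> gG; apply: ereal_sup_ubound; exists g. Qed.

Lemma C_R_g_le_C_R g (eps : R) gam : in_G g -> (C_R_g g eps gam <= C_R eps gam)%E.
Proof. by move=> gG; apply: ereal_sup_ubound; exists g. Qed.

End weight_functions.

(** * The standard normal distribution *)

Section real_derivatives.
Variable R : realType.
Implicit Types (f g : R -> R) (x : R).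

(** The differentiation rules are stated for explicit abstractions, so that [derive_step] can select
    them by the shape of the function. *)
Lemma derive_cst x (c : R) : is_derive x 1 (fun _ => c) 0.
Proof. exact: is_derive_cst. Qed.

Lemma derive_id x : is_derive x 1 (fun y : R => y) 1.
Proof. exact: is_derive_id. Qed.

Lemma derive_add x f g (f' g' : R) : is_derive x 1 f f' -> is_derive x 1 g g' ->
  is_derive x 1 (fun y => f y + g y) (f' + g').
Proof. exact: is_deriveD. Qed.

Lemma derive_opp x f (f' : R) : is_derive x 1 f f' ->
  is_derive x 1 (fun y => - f y) (- f').
Proof. exact: is_deriveN. Qed.

Lemma derive_mul x f g (f' g' : R) : is_derive x 1 f f' -> is_derive x 1 g g' ->
  is_derive x 1 (fun y => f y * g y) (f x * g' + g x * f').
Proof. exact: is_deriveM. Qed.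

Lemma derive_exp x f (f' : R) n : is_derive x 1 f f' ->
  is_derive x 1 (fun y => f y ^+ n.+1) (n.+1%:R * f x ^+ n * f').
Proof.
move=> df; rewrite (_ : (fun y => f y ^+ n.+1) = f ^+ n.+1); last first.
  by apply/funext => y; rewrite exprfctE.
exact: is_deriveX.
Qed.

Lemma derive_expR x f (f' : R) : is_derive x 1 f f' ->
  is_derive x 1 (fun y => expR (f y)) (expR (f x) * f').
Proof. by move=> df; exact: is_derive1_comp. Qed.

Lemma derive_inv x f (f' : R) : f x != 0 -> is_derive x 1 f f' ->
  is_derive x 1 (fun y => (f y)^-1) (- f x ^- 2 * f').
Proof. by move=> fx0 df; exact: (@is_deriveV R f x f' 1 fx0 df). Qed.

Lemma derive_continuous f x (f' : R) : is_derive x 1 f f' -> {for x, continuous f}.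
Proof. by case=> df _; apply/differentiable_continuous/derivable1_diffP. Qed.

(** By the mean value theorem; inequalities between functions are obtained below by applying this to
    their difference. *)
Lemma derive_ge0_le f f' (a b : R) : a <= b ->
  (forall x, a <= x <= b -> is_derive x 1 f (f' x)) ->
  (forall x, a <= x <= b -> 0 <= f' x) -> f a <= f b.
Proof.
move=> ab df f'0.
have [||c cab Efab] := @MVT_segment R f f' a b ab.
- by move=> x; rewrite in_itv/= => /andP[ax xb]; apply: df; rewrite !ltW.
- apply: continuous_in_subspaceT => x; rewrite inE/= in_itv/= => xab.
  exact: derive_continuous (df x xab).
- rewrite -subr_ge0 Efab mulr_ge0 ?subr_ge0//; apply: f'0.
  by move: cab; rewrite in_itv.
Qed.

End real_derivatives.

Ltac derive_step := first
  [ eapply derive_cst | eapply derive_id | eassumption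
  | eapply derive_add | eapply derive_opp | eapply derive_exp
  | eapply derive_mul | eapply derive_expR ].
(** [H], the derivative of a special function, is tried before the general rules; what remains is to
    identify the computed derivative with the claimed one. *)
Ltac derive_with H :=
  eapply is_derive_eq; [repeat first [eapply H | derive_step] | cbv beta].

Section standard_normal.
Variable R : realType.
Implicit Types x y : R.

Definition gauss_peak : R := (Num.sqrt (pi *+ 2))^-1.
Definition phi x : R := gauss_peak * expR (- (x ^+ 2 / 2)).

Lemma phiE : phi = normal_pdf 0 1.
Proof.
apply/funext => x; rewrite normal_pdfE ?oner_eq0// /phi /gauss_peak /normal_peak.
by rewrite /normal_fun expr1n mul1r subr0 mulNr.
Qed.

Lemma gauss_peak_gt0 : 0 < gauss_peak.
Proof. by rewrite invr_gt0 sqrtr_gt0 mulrn_wgt0// pi_gt0. Qed.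

Lemma phi_gt0 x : 0 < phi x.
Proof. by rewrite mulr_gt0 ?expR_gt0// gauss_peak_gt0. Qed.

Lemma phi_le_peak x : phi x <= gauss_peak.
Proof.
rewrite /phi ler_piMr ?(ltW gauss_peak_gt0)// expR_le1 oppr_le0.
by rewrite divr_ge0// sqr_ge0.
Qed.

(** Adding the end point, a null set, gives the form to which the fundamental theorem of calculus
    applies. *)
Lemma Phi_Rintegral x :
  Phi x = Rintegral lebesgue_measure `]-oo, x] (normal_pdf 0 1).
Proof.
rewrite /Phi /normal_prob /Rintegral.
rewrite -integral_itv_bndo_bndc//; apply/measurable_EFinP/measurable_funTS.
exact: measurable_normal_pdf.
Qed.

Lemma derive_Phi x : is_derive x 1 (@Phi R) (phi x).
Proof.
rewrite (_ : @Phi R = fun y => Rintegral lebesgue_measure `]-oo, y] (normal_pdf 0 1)).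
  have pdf_int : lebesgue_measure.-integrable [set` Interval -oo%O (BRight (x + 1))]
      (EFin \o normal_pdf 0 1).
    by apply: (integrableS _ _ (@subsetT _ _)) => //; exact: integrable_normal_pdf.
  have pdf_cont : {for x, continuous (normal_pdf 0 1)}.
    exact: (continuous_normal_pdf (oner_neq0 R)).
  have x_lt : x < x + 1 by rewrite ltrDl.
  have [dF F'] := continuous_FTC1 x_lt pdf_int (ltNyr x) pdf_cont.
  by rewrite phiE -F' derive1E; exact: derivableP.
by apply/funext => y; exact: Phi_Rintegral.
Qed.

(** The density is even, so the half-line from 0 carries half of the total mass. *)
Lemma Phi0 : @Phi R 0 = 2^-1.
Proof.
have even_pdf : normal_pdf 0 1 =1 normal_pdf 0 1 \o (-%R : R -> R).
  by move=> x; rewrite -phiE /= /phi sqrrN.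
have := @ge0_symfun_integralT R (normal_pdf 0 1) (normal_pdf_ge0 0 1)
  (continuous_normal_pdf (oner_neq0 R)) even_pdf.
rewrite integral_normal_pdf => half.
have C0 : [set x : R | 0 <= x] = ~` `]-oo, 0[%classic.
  by rewrite setCitvl; apply/seteqP; split => x /=; rewrite in_itv/= andbT.
have PC : normal_prob 0 1 [set x : R | 0 <= x] = (1 - normal_prob 0 1 `]-oo, 0%R[)%E.
  by rewrite C0 probability_setC.
have fin : normal_prob 0 1 `]-oo, (0 : R)[ \is a fin_num by exact: fin_num_measure.
move: half; rewrite -[X in (_ * X)%E]/(normal_prob 0 1 [set x : R | 0 <= x]) PC.
rewrite -(fineK fin) -/(Phi 0) -EFinB -EFinM => -[]; lra.
Qed.

(** The density never exceeds its peak. This is the Lipschitz bound required by [Deltan_ge_jump]. *)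
Lemma phi_diff_le x y : x <= y -> Phi y - Phi x <= gauss_peak * (y - x).
Proof.
move=> xy.
have := @derive_ge0_le R (fun z => gauss_peak * z - Phi z)
  (fun z => gauss_peak - phi z) x y xy.
have df (z : R) : is_derive z (1 : R)
    (fun z => gauss_peak * z - Phi z) (gauss_peak - phi z).
  derive_with (@derive_Phi); ring.
move=> /(_ (fun z _ => df z)) incr.
have /incr : forall z, x <= z <= y -> 0 <= gauss_peak - phi z.
  by move=> z _; rewrite subr_ge0 phi_le_peak.
lra.
Qed.

End standard_normal.

(** * Rational bounds for exp, sin, pi and the peak of the density *)

Section numerics.
Variable R : realType.
Implicit Types x u : R.

Definition exp_sum n u : R := \sum_(i < n) (- u) ^+ i / i`!%:R.

Lemma exp_sum0 n : exp_sum n.+1 0 = 1.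
Proof.
rewrite /exp_sum oppr0 big_ord_recl/= expr0 fact0 divr1 big1 ?addr0// => i _.
by rewrite expr0n mul0r.
Qed.

Lemma derive_exp_sum n u : is_derive u 1 (exp_sum n.+1) (- exp_sum n u).
Proof.
elim: n => [|n IHn].
  rewrite /exp_sum big_ord0 oppr0.
  rewrite (_ : (fun v => _) = fun=> 1); first exact: derive_cst.
  by apply/funext => v; rewrite big_ord_recl big_ord0 expr0 fact0 divr1 addr0.
rewrite (_ : exp_sum n.+2 =
  fun v => exp_sum n.+1 v + (- v) ^+ n.+1 / n.+1`!%:R); last first.
  by apply/funext => v; rewrite /exp_sum big_ord_recr.
derive_with IHn.
rewrite /exp_sum big_ord_recr/= -/(exp_sum n u) factS natrM.
have : n.+1%:R != 0 :> R by rewrite pnatr_eq0.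
have : n`!%:R != 0 :> R by rewrite pnatr_eq0 -lt0n fact_gt0.
by move=> ? ?; field; apply/andP.
Qed.

(** Induction on [n]: the next signed remainder vanishes at 0, and its derivative is the present
    one. *)
Lemma expRN_alternating n u : 0 <= u -> 0 <= (-1) ^+ n * (expR (- u) - exp_sum n u).
Proof.
elim: n u => [|n IHn] u u0.
  by rewrite expr0 mul1r /exp_sum big_ord0 subr0 expR_ge0.
pose f v : R := (-1) ^+ n.+1 * (expR (- v) - exp_sum n.+1 v).
have f0 : f 0 = 0 by rewrite /f exp_sum0 oppr0 expR0 subrr mulr0.
rewrite -/(f u) -f0.
apply: (derive_ge0_le u0 (f' := fun v => (-1) ^+ n * (expR (- v) - exp_sum n v))).
  move=> v _; rewrite /f; have d := derive_exp_sum n v.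
  derive_with d; rewrite exprS; ring.
by move=> v /andP[v0 _]; exact: IHn.
Qed.

(** Starting from [cos <= 1], each inequality is integrated from 0 to give the next Taylor bound,
    alternately for sine and cosine. *)
Lemma sin_bounds x : 0 <= x ->
  x - x ^+ 3 / 6 + x ^+ 5 / 120 - x ^+ 7 / 5040 <= sin x
    <= x - x ^+ 3 / 6 + x ^+ 5 / 120.
Proof.
have integrate (f f' : R -> R) : f 0 = 0 -> (forall y : R, is_derive y 1 f (f' y)) ->
    (forall y, 0 <= y -> 0 <= f' y) -> forall y, 0 <= y -> 0 <= f y.
  move=> f0 df f'0 y y0; rewrite -f0; apply: (derive_ge0_le y0 (fun z _ => df z)).
  by move=> z /andP[z0 _]; exact: f'0.
pose dsin := @is_derive_sin R; pose dcos := @is_derive_cos R.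
have s1 : forall y : R, 0 <= y -> 0 <= y - sin y.
  have d (y : R) : is_derive y 1 (fun y : R => y - sin y) (1 - cos y).
    derive_with dsin; ring.
  apply: (integrate _ _ _ d); last by move=> y _; rewrite subr_ge0 cos_le1.
  by rewrite sin0; ring.
have c2 : forall y : R, 0 <= y -> 0 <= cos y - 1 + y ^+ 2 / 2.
  have d (y : R) : is_derive y 1 (fun y : R => cos y - 1 + y ^+ 2 / 2) (y - sin y).
    derive_with dcos; lra.
  apply: (integrate _ _ _ d); last exact: s1.
  by rewrite cos0; ring.
have s3 : forall y : R, 0 <= y -> 0 <= sin y - y + y ^+ 3 / 6.
  have d (y : R) : is_derive y 1
      (fun y : R => sin y - y + y ^+ 3 / 6)
      (cos y - 1 + y ^+ 2 / 2).
    derive_with dsin; lra.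
  apply: (integrate _ _ _ d); last exact: c2.
  by rewrite sin0; ring.
have c4 : forall y : R, 0 <= y -> 0 <= 1 - y ^+ 2 / 2 + y ^+ 4 / 24 - cos y.
  have d (y : R) : is_derive y 1
      (fun y : R => 1 - y ^+ 2 / 2 + y ^+ 4 / 24 - cos y)
      (sin y - y + y ^+ 3 / 6).
    derive_with dcos; lra.
  apply: (integrate _ _ _ d); last exact: s3.
  by rewrite cos0; ring.
have s5 : forall y : R, 0 <= y -> 0 <= y - y ^+ 3 / 6 + y ^+ 5 / 120 - sin y.
  have d (y : R) : is_derive y 1
      (fun y : R => y - y ^+ 3 / 6 + y ^+ 5 / 120 - sin y)
      (1 - y ^+ 2 / 2 + y ^+ 4 / 24 - cos y).
    derive_with dsin; lra.
  apply: (integrate _ _ _ d); last exact: c4.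
  by rewrite sin0; ring.
have c6 : forall y : R, 0 <= y ->
    0 <= cos y - 1 + y ^+ 2 / 2 - y ^+ 4 / 24 + y ^+ 6 / 720.
  have d (y : R) : is_derive y 1
      (fun y : R => cos y - 1 + y ^+ 2 / 2 - y ^+ 4 / 24 + y ^+ 6 / 720)
      (y - y ^+ 3 / 6 + y ^+ 5 / 120 - sin y).
    derive_with dcos; lra.
  apply: (integrate _ _ _ d); last exact: s5.
  by rewrite cos0; ring.
have s7 : forall y : R, 0 <= y ->
    0 <= sin y - y + y ^+ 3 / 6 - y ^+ 5 / 120 + y ^+ 7 / 5040.
  have d (y : R) : is_derive y 1
      (fun y : R => sin y - y + y ^+ 3 / 6 - y ^+ 5 / 120 + y ^+ 7 / 5040)
      (cos y - 1 + y ^+ 2 / 2 - y ^+ 4 / 24 + y ^+ 6 / 720).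
    derive_with dsin; lra.
  apply: (integrate _ _ _ d); last exact: c6.
  by rewrite sin0; ring.
move=> x0; have := s5 x x0; have := s7 x x0; lra.
Qed.

(** By the triple-angle formula at [pi / 2], [s] is a root of [(s + 1) * (2 * s - 1) ^+ 2];
    positivity excludes -1. *)
Lemma sin_pi_div6 : sin (pi / 6) = 2^-1 :> R.
Proof.
set y : R := pi / 6; set s := sin y.
have s0 : 0 < s.
  by apply: sin_gt0_pi; have := @pi_gt0 R; rewrite /y => ?; apply/andP; split; lra.
have s3y : sin (y + y + y) = 1.
  by rewrite (_ : y + y + y = pi / 2) ?sin_pihalf// /y; field.
have c2 : cos y ^+ 2 = 1 - s ^+ 2 by rewrite cos2sin2.
have factored : (s + 1) * (2 * s - 1) ^+ 2 = 0.
  move: s3y; rewrite sinD sinD cosD -/s.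
  move: c2; set c := cos y => c2 H.
  have : (s * c + c * s) * c + (c * c - s * s) * s = 3 * s * c ^+ 2 - s ^+ 3 by ring.
  rewrite H c2 => E.
  rewrite (_ : _ * _ = 1 - (3 * s * (1 - s ^+ 2) - s ^+ 3)); last by ring.
  by rewrite -E subrr.
move/eqP: factored; rewrite mulf_eq0 expf_eq0/= => /orP[/eqP|/eqP]; lra.
Qed.

(** One sixth of each bound is compared with [pi / 6] through the sine, which increases there: the
    Taylor bounds put [sin (111 / 212)] below 1/2 and [sin (355 / 678)] above it. *)
Lemma pi_bounds : 333 / 106 < (pi : R) < 355 / 113.
Proof.
have pi0 := @pi_gt0 R.
have in_dom (y : R) : 0 <= y <= pi / 2 -> y \in `[- (pi / 2), pi / 2]%R.
  by move=> /andP[y0 y1]; rewrite in_itv/= y1 andbT (le_trans _ y0)// oppr_le0 divr_ge0// ltW.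
have p2 := @pi_ge2 R.
have mono := @ltr_sin R.
apply/andP; split.
  have xd : (111 / 212 : R) \in `[- (pi / 2), pi / 2]%R by apply: in_dom; lra.
  have yd : (pi / 6 : R) \in `[- (pi / 2), pi / 2]%R by apply: in_dom; lra.
  have := mono _ _ xd yd; rewrite sin_pi_div6.
  have /andP[_ s5] : _ <= sin (111 / 212 : R) <= _ := @sin_bounds (111 / 212) ltac:(lra).
  have -> : sin (111 / 212 : R) < 2^-1.
    by apply: (le_lt_trans s5); lra.
  by move=> /esym; lra.
have xd : (355 / 678 : R) \in `[- (pi / 2), pi / 2]%R by apply: in_dom; lra.
have yd : (pi / 6 : R) \in `[- (pi / 2), pi / 2]%R by apply: in_dom; lra.
have := mono _ _ yd xd; rewrite sin_pi_div6.
have /andP[s7 _] : _ <= sin (355 / 678 : R) <= _ := @sin_bounds (355 / 678) ltac:(lra).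
have -> : 2^-1 < sin (355 / 678 : R).
  by apply: (lt_le_trans _ s7); lra.
by move=> /esym; lra.
Qed.

(** The bounds on pi transfer to the peak [c] through [c ^+ 2 * (2 * pi) = 1]; in decimals they are
    0.39894 and 0.39895. *)
Lemma gauss_peak_bounds : 19947 / (5 * 10 ^+ 4) < gauss_peak R < 7979 / (2 * 10 ^+ 4).
Proof.
have /andP[pi_lo pi_hi] := pi_bounds; have c0 := @gauss_peak_gt0 R.
have c2 : gauss_peak R ^+ 2 * (2 * pi) = 1.
  have pi2_gt0 : 0 < (pi : R) *+ 2 by rewrite mulrn_wgt0// pi_gt0.
  rewrite /gauss_peak exprVn sqr_sqrtr ?(ltW pi2_gt0)// mulr_natl mulVf//.
  by rewrite gt_eqF.
move: c2 c0 pi_lo pi_hi; move: (gauss_peak R) (pi : R) => c p c2 c0 p_lo p_hi.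
have p0 : 0 <= 2 * p by move: p_lo; clear; lra.
have c20 : 0 <= c * c by rewrite mulr_ge0 ?(ltW c0).
rewrite expr2 in c2; apply/andP; split; rewrite ltNge; apply/negP => hc.
  have cc := ler_pM (ltW c0) (ltW c0) hc hc.
  have pp : 2 * p <= 2 * (355 / 113) by move: p_hi; clear; lra.
  by have := ler_pM c20 p0 cc pp; rewrite c2; clear; lra.
have k0 : 0 <= 7979 / (2 * 10 ^+ 4) :> R by clear; lra.
have cc := ler_pM k0 k0 hc hc.
have pp : 2 * (333 / 106) <= 2 * p by move: p_lo; clear; lra.
have p0' : 0 <= 2 * (333 / 106) :> R by clear; lra.
by have := ler_pM (mulr_ge0 k0 k0) p0' cc pp; rewrite c2; clear; lra.
Qed.

End numerics.

(** * Bounds for the normal distribution function and the profile *)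

Section normal_numerics.
Variable R : realType.
Implicit Types x t : R.

Lemma exp_sum6 (u : R) :
  exp_sum 6 u = 1 - u + u ^+ 2 / 2 - u ^+ 3 / 6 + u ^+ 4 / 24 - u ^+ 5 / 120.
Proof.
rewrite /exp_sum !big_ord_recr/= big_ord0 /factorial/= !natrM; lra.
Qed.

Lemma phi_bounds x :
  gauss_peak R * (1 - x ^+ 2 / 2 + x ^+ 4 / 8 - x ^+ 6 / 48) <= phi x
    <= gauss_peak R * (1 - x ^+ 2 / 2 + x ^+ 4 / 8).
Proof.
have u0 : 0 <= x ^+ 2 / 2 by rewrite divr_ge0// sqr_ge0.
have c0 := @gauss_peak_gt0 R.
have := expRN_alternating 3 u0; have := expRN_alternating 4 u0.
rewrite /exp_sum !big_ord_recr/= !big_ord0 !factS fact0 /phi.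
move=> lo hi; rewrite !ler_pM2l//; apply/andP; split.
  by move: lo; rewrite !exprS !expr0; lra.
by move: hi; rewrite !exprS !expr0; lra.
Qed.

(** The upper bound of [phi_bounds], integrated from 0. *)
Lemma Phi_upper x : 0 <= x ->
  Phi x <= 2^-1 + gauss_peak R * (x - x ^+ 3 / 6 + x ^+ 5 / 40).
Proof.
move=> x0; pose c := gauss_peak R.
have d (y : R) : is_derive y 1
    (fun y : R => c * (y - y ^+ 3 / 6 + y ^+ 5 / 40) - Phi y)
    (c * (1 - y ^+ 2 / 2 + y ^+ 4 / 8) - phi y).
  derive_with (@derive_Phi R); lra.
have := derive_ge0_le x0 (fun y _ => d y); rewrite Phi0 !expr0n !mul0r subr0 !addr0 mulr0.
move=> /(_ _)/wrap[y _|]; last by rewrite -/c; lra.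
by have /andP[_] := phi_bounds y; rewrite subr_ge0.
Qed.

(** Six terms of the series of the density, integrated from 0. Four would yield only 0.3412 at
    [x = 1], too little for [Phi1_lower]. *)
Lemma Phi_lower x : 0 <= x ->
  2^-1 + gauss_peak R * (x - x ^+ 3 / 6 + x ^+ 5 / 40 - x ^+ 7 / 336
                         + x ^+ 9 / 3456 - x ^+ 11 / (3840 * 11)) <= Phi x.
Proof.
move=> x0; pose c := gauss_peak R; have c0 : 0 < c := @gauss_peak_gt0 R.
have d (y : R) : is_derive y 1
    (fun y : R => Phi y - c * (y - y ^+ 3 / 6 + y ^+ 5 / 40 - y ^+ 7 / 336
                               + y ^+ 9 / 3456 - y ^+ 11 / (3840 * 11)))
    (phi y - c * (1 - y ^+ 2 / 2 + y ^+ 4 / 8 - y ^+ 6 / 48 + y ^+ 8 / 384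
                  - y ^+ 10 / 3840)).
  derive_with (@derive_Phi R); lra.
have := derive_ge0_le x0 (fun y _ => d y); rewrite Phi0 !expr0n !mul0r subr0 !addr0 !subr0 mulr0.
move=> /(_ _)/wrap[y _|]; last by rewrite -/c; lra.
have u0 : 0 <= y ^+ 2 / 2 by rewrite divr_ge0// sqr_ge0.
have := expRN_alternating 6 u0.
rewrite exp_sum6 -signr_odd mul1r /phi -/c -mulrBr => lo.
apply: mulr_ge0; first exact: ltW.
rewrite !(exprM y 2 2, exprM y 2 3, exprM y 2 4, exprM y 2 5).
by move: (y ^+ 2) lo => v; lra.
Qed.

Lemma Phi_ge_half x : 0 <= x -> 2^-1 <= Phi x.
Proof.
move=> x0; rewrite -(@Phi0 R); apply: (derive_ge0_le x0 (fun y _ => derive_Phi y)).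
by move=> y _; exact/ltW/phi_gt0.
Qed.

Lemma Phi_le_linear x : 0 <= x -> Phi x <= 2^-1 + 399 / 1000 * x.
Proof.
move=> x0; have := phi_diff_le x0; rewrite Phi0 subr0.
have /andP[_ c1] := gauss_peak_bounds R.
have : gauss_peak R * x <= 399 / 1000 * x by apply: ler_wpM2r => //; lra.
lra.
Qed.

Lemma Phi1_lower : 3413 / 10000 < Phi 1 - 2^-1 :> R.
Proof.
have := @Phi_lower 1 ler01; rewrite !expr1n.
by have /andP[] := gauss_peak_bounds R; lra.
Qed.

(* With t = sqrt (q / p) the quotient of the last display of the theorem
   becomes a function of t without square roots. *)
Definition profile t : R := ((1 + t ^+ 2) * Phi t - t ^+ 2) / (1 + t ^+ 3).

(** Numerator of the derivative of [profile] over [(1 + t ^+ 3) ^+ 2]. *)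
Definition profile_slope t : R :=
  Phi t * (2 * t - 3 * t ^+ 2 - t ^+ 4) + phi t * ((1 + t ^+ 2) * (1 + t ^+ 3))
  - 2 * t + t ^+ 4.

Lemma derive_phi x : is_derive x 1 (@phi R) (- x * phi x).
Proof. by rewrite /phi; derive_with (@derive_id R); lra. Qed.

Lemma derive_profile t : 0 <= t ->
  is_derive t 1 profile (profile_slope t / (1 + t ^+ 3) ^+ 2).
Proof.
move=> t0; have D0 : 1 + t ^+ 3 != 0 by rewrite gt_eqF// ltr_pwDl// exprn_ge0.
have dV := @derive_inv R t (fun y => 1 + y ^+ 3) (3 * t ^+ 2) D0.
have {}dV : is_derive t 1 (fun y : R => (1 + y ^+ 3)^-1)
    (- (1 + t ^+ 3) ^- 2 * (3 * t ^+ 2)).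
  apply: dV; derive_with (@derive_id R); ring.
rewrite /profile; derive_with (@derive_Phi R).
by rewrite /profile_slope; field.
Qed.

Lemma profile_slope_decreasing s t : 0 <= s -> s <= t -> t <= 1 ->
  profile_slope t <= profile_slope s.
Proof.
move=> s0 st t1.
(* The derivative of [profile_slope], simplified by the rule that [phi] has derivative
   [- y * phi y]; it has to be non-positive. *)
pose slope' y : R := phi y * (3 * y - y ^+ 3 + 3 * y ^+ 4 - y ^+ 6)
  + Phi y * (2 - 6 * y - 4 * y ^+ 3) - 2 + 4 * y ^+ 3.
have d (y : R) : is_derive y 1 (fun y => - profile_slope y) (- slope' y).
  rewrite /profile_slope /slope'; have d1 := derive_Phi y; have d2 := derive_phi y.
  by derive_with (@derive_id R); lra.
have := derive_ge0_le st (fun y _ => d y).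
move=> /(_ _)/wrap[y /andP[sy yt]|]; last by lra.
have y0 : 0 <= y by lra.
have y1 : y <= 1 by lra.
have /andP[_ c1] := gauss_peak_bounds R.
have := phi_gt0 y; have := phi_le_peak y; have := Phi_ge_half y0; have := Phi_le_linear y0.
rewrite oppr_ge0 /slope'; move: (phi y) (Phi y) => h H H1 H0 h1 h0.
have y3 : y ^+ 3 <= y by rewrite -[leRHS]expr1 ler_wiXn2l.
have y43 : y ^+ 4 <= y ^+ 3 by rewrite ler_wiXn2l.
have y64 : y ^+ 6 <= y ^+ 4 by rewrite ler_wiXn2l.
have y2 : 0 <= y ^+ 2 by rewrite exprn_ge0.
have y30 : 0 <= y ^+ 3 by rewrite exprn_ge0.
have y40 : 0 <= y ^+ 4 by rewrite exprn_ge0.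
have y60 : 0 <= y ^+ 6 by rewrite exprn_ge0.
have B0 : 0 <= 3 * y - y ^+ 3 + 3 * y ^+ 4 - y ^+ 6.
  by move: y0 y3 y64 y40; clear; lra.
have h25 : h <= 2 / 5 by move: h1 c1; clear; lra.
have hB := ler_wpM2r B0 h25.
(* The sign of the factor of [Phi y] decides whether [Phi y] is replaced by its linear upper bound
   or by 1/2. *)
have [A0|A0] := leP 0 (2 - 6 * y - 4 * y ^+ 3).
  by have := ler_wpM2r A0 H1; move: hB y0 y1 y2 y3 y30 y40 y60; clear; lra.
have := ler_wnM2r (ltW A0) H0.
by move: hB y0 y1 y3 y43 y30 y40 y60; clear; lra.
Qed.

(** The points 39/121 and 69/214 enclose the critical point so tightly that [1 / (1 + t ^+ 2)]
    begins with 0.9058 on the whole interval. *)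
Lemma profile_slope_gt0 : 0 < profile_slope (39 / 121).
Proof.
rewrite /profile_slope.
have /andP[+ _] := phi_bounds (39 / 121).
have := @Phi_lower (39 / 121) ltac:(lra).
have /andP[] := gauss_peak_bounds R.
move: (gauss_peak R) (Phi _) (phi _) => c H h; lra.
Qed.

Lemma profile_slope_lt0 : profile_slope (69 / 214) < 0.
Proof.
rewrite /profile_slope.
have /andP[_] := phi_bounds (69 / 214).
have := @Phi_upper (69 / 214) ltac:(lra).
have /andP[] := gauss_peak_bounds R.
move: (gauss_peak R) (Phi _) (phi _) => c H h; lra.
Qed.

Lemma profile_nondecreasing s t : 0 <= s -> s <= t -> t <= 39 / 121 ->
  profile s <= profile t.
Proof.
move=> s0 st t1.
apply: (derive_ge0_le st (f' := fun y => profile_slope y / (1 + y ^+ 3) ^+ 2)).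
  by move=> y /andP[sy _]; apply: derive_profile; lra.
move=> y /andP[sy yt]; rewrite divr_ge0 ?sqr_ge0//.
apply: (le_trans (ltW profile_slope_gt0)).
by apply: profile_slope_decreasing; lra.
Qed.

Lemma profile_nonincreasing s t : 69 / 214 <= s -> s <= t -> t <= 1 ->
  profile t <= profile s.
Proof.
move=> s0 st t1; rewrite -lerN2.
apply: (derive_ge0_le (f := fun y => - profile y) st
  (f' := fun y => - (profile_slope y / (1 + y ^+ 3) ^+ 2))).
  by move=> y /andP[sy _]; apply: derive_opp; apply: derive_profile; lra.
move=> y /andP[sy yt]; rewrite oppr_ge0 mulr_le0_ge0 ?invr_ge0 ?sqr_ge0//.
apply: le_trans (ltW profile_slope_lt0).
by apply: profile_slope_decreasing; lra.
Qed.

(** A maximum exists on the compact bracket, and monotonicity outside it makes that maximum global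
    on the unit interval. *)
Lemma profile_max : exists2 t0, 39 / 121 <= t0 <= 69 / 214 &
  forall t, 0 < t < 1 -> profile t <= profile t0.
Proof.
have cont : {within `[39 / 121, 69 / 214], continuous profile}.
  apply: continuous_in_subspaceT => t; rewrite inE/= in_itv/= => /andP[t0 _].
  by apply: derive_continuous; apply: derive_profile; lra.
have ab : 39 / 121 <= 69 / 214 :> R by lra.
have [t0 t0_in t0_max] := EVT_max ab cont.
have le_t0 t : 39 / 121 <= t <= 69 / 214 -> profile t <= profile t0.
  by move=> tab; apply: t0_max; rewrite in_itv.
exists t0 => [|t /andP[tgt0 tlt1]]; first by move: t0_in; rewrite in_itv.
have [t_lo|t_lo] := leP t (39 / 121).
  apply: le_trans (le_t0 (39 / 121) _); last by lra.
  by apply: profile_nondecreasing; lra.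
have [t_hi|t_hi] := leP (69 / 214) t; last by apply: le_t0; rewrite !ltW.
apply: le_trans (le_t0 (69 / 214) _); last by lra.
by apply: profile_nonincreasing; lra.
Qed.

Lemma profile_10_31 : 5685 / 10000 < profile (10 / 31).
Proof.
rewrite /profile ltr_pdivlMr; last by lra.
have := @Phi_lower (10 / 31) ltac:(lra).
have /andP[] := gauss_peak_bounds R.
move: (gauss_peak R) (Phi _) => c H; lra.
Qed.

(** A crude bound suffices: 0.576 is the value that the lattice example attains in [C_E_min1_ge]. *)
Lemma profile_le t : 0 < t -> profile t <= 576 / 1000.
Proof.
move=> t0; rewrite /profile ler_pdivrMr; last by rewrite addr_gt0 ?exprn_gt0.
have := Phi_le_linear (ltW t0) => H.
have : (1 + t ^+ 2) * Phi t <= (1 + t ^+ 2) * (2^-1 + 399 / 1000 * t).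
  by apply: ler_wpM2l; rewrite // addr_ge0 ?sqr_ge0.
(* What remains is a cubic positive for [t > 0] with minimum near 0.338. The two certificates have
   their double zeros close to it, and the factor [t + 70 / 100] cancels the quadratic term of the
   second. *)
have := sqr_ge0 (t - 334 / 1000).
have : 0 <= (t - 35 / 100) ^+ 2 * (t + 70 / 100).
  by rewrite mulr_ge0 ?sqr_ge0//; lra.
rewrite !exprS !expr0; lra.
Qed.

End normal_numerics.

(** * Two-point summands *)

Section two_point.
Variables (R : realType) (t : R).
Hypotheses (t0 : 0 < t) (t1 : t <= 1).

Let p : R := (1 + t ^+ 2)^-1.
Let q : R := t ^+ 2 / (1 + t ^+ 2).

Let D_gt0 : 0 < 1 + t ^+ 2.
Proof. by rewrite ltr_pwDl// sqr_ge0. Qed.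

Let t_le_inv : t <= t^-1.
Proof. by rewrite (le_trans t1)// invf_ge1. Qed.

Definition two_point_weight (j : 'I_2) : R := if j == ord0 then p else q.

Let weight_ge0 j : 0 <= two_point_weight j.
Proof.
by rewrite /two_point_weight; case: ifP => _; rewrite ?invr_ge0 ?divr_ge0 ?sqr_ge0 ?ltW.
Qed.

Let weight_sum : \sum_j two_point_weight j = 1.
Proof.
rewrite big_ord_recl big_ord1 /two_point_weight /= /p /q.
by field; rewrite gt_eqF.
Qed.

Definition two_point_law := Law weight_ge0 weight_sum.

Definition two_point_value (i : 'I_1) (j : 'I_2) : R := if j == ord0 then t else - t^-1.

Definition two_point_X := X (fun _ : 'I_1 => two_point_law) two_point_value.

Let mean0 i : \sum_j two_point_law j * two_point_value i j = 0.
Proof.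
rewrite big_ord_recl big_ord1 /= /two_point_weight /two_point_value /= /p /q.
by field; rewrite !gt_eqF.
Qed.

Let var1 : \sum_(i < 1) \sum_j two_point_law j * two_point_value i j ^+ 2 = 1.
Proof.
rewrite big_ord1 big_ord_recl big_ord1 /= /two_point_weight /two_point_value /= /p /q.
by field; rewrite !gt_eqF.
Qed.

Let adm : admissible two_point_X. Proof. exact: admissible_X. Qed.
Let B1 : Bn two_point_X = 1. Proof. exact: Bn_X. Qed.

Let MnE z : Mn two_point_X z =
  p * (if t < z then t ^+ 3 else 0) - q * (if t^-1 < z then t ^- 3 else 0).
Proof.
rewrite Mn_X// big_ord1 big_ord_recl big_ord1 /= /two_point_weight /two_point_value /=.
rewrite normrN normfV !gtr0_norm//.
have -> : (- t^-1) ^+ 3 = - t ^- 3 by rewrite exprNn exprVn -signr_odd mulN1r.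
by case: (t^-1 < z); rewrite ?mulrN ?mulr0 ?subr0 ?addr0.
Qed.

Let LnE z : Ln two_point_X z =
  p * (if z <= t then t ^+ 2 else 0) + q * (if z <= t^-1 then t ^- 2 else 0).
Proof.
rewrite Ln_X// big_ord1 big_ord_recl big_ord1 /= /two_point_weight /two_point_value /=.
by rewrite normrN normfV !gtr0_norm// sqrrN exprVn.
Qed.

Let Mn_low z : z <= t -> Mn two_point_X z = 0.
Proof.
move=> zt; rewrite MnE ltNge zt ltNge (le_trans zt t_le_inv)/=.
by rewrite !mulr0 subrr.
Qed.

Let Mn_mid z : t < z -> z <= t^-1 -> Mn two_point_X z = p * t ^+ 3.
Proof. by move=> tz zt; rewrite MnE tz ltNge zt/= mulr0 subr0. Qed.

Let Mn_high z : t^-1 < z -> Mn two_point_X z = - (t^-1 - t).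
Proof.
move=> tz; rewrite MnE tz (le_lt_trans t_le_inv tz) /p /q.
by field; rewrite !gt_eqF.
Qed.

Let Ln_low z : z <= t -> Ln two_point_X z = 1.
Proof.
move=> zt; rewrite LnE zt (le_trans zt t_le_inv) /p /q.
by field; rewrite !gt_eqF.
Qed.

Let Ln_mid z : t < z -> z <= t^-1 -> Ln two_point_X z = p.
Proof.
move=> tz zt; rewrite LnE zt leNgt tz /= /p /q.
by field; rewrite !gt_eqF.
Qed.

Let Ln_high z : t^-1 < z -> Ln two_point_X z = 0.
Proof.
move=> tz; rewrite LnE leNgt (le_lt_trans t_le_inv tz) leNgt tz.
by rewrite !mulr0 addr0.
Qed.

Let Deltan_two_point : Phi t - q <= Deltan two_point_X.
Proof.
(* The strict inequality in the event excludes the atom at [t], so that only the mass [q] is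
   left. *)
apply: le_trans (Deltan_ge two_point_X t); rewrite distrC.
apply: le_trans (ler_norm _); rewrite lerD2l lerN2.
set A := [set w | _].
have AE (w : outcome 1 1) : \1_A w = (if w ord0 == ord0 then 0 else 1) :> R.
  rewrite indicE; have -> : (w \in A) = (w ord0 != ord0); last by case: eqP.
  rewrite /A B1; apply/idP/idP => [/set_mem|w0].
    rewrite /= divr1 /Sn big_ord1 /two_point_X /= /coordinate /two_point_value.
    by case: eqP => //; rewrite ltxx.
  apply/mem_set; rewrite /= divr1 /Sn big_ord1 /two_point_X /= /coordinate.
  by rewrite /two_point_value (negbTE w0) (lt_trans _ t0)// oppr_lt0 invr_gt0.
have -> : fine (product_law (fun=> two_point_law) A) = q; last by [].
rewrite product_lawE /=; under eq_bigr do rewrite AE.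
rewrite (sum_coordinate (fun=> two_point_law) ord0 (fun j => if j == ord0 then 0 else 1)).
by rewrite big_ord_recl big_ord1 /= /two_point_weight /= mulr0 add0r mulr1.
Qed.

Let p_gt0 : 0 < p. Proof. by rewrite invr_gt0. Qed.

(** The three conditions correspond to the ranges of [z] cut at the jumps [t] and [t^-1], on each of
    which [Mn] and [Ln] are constant. *)
Lemma two_point_C_E_g g (eps : \bar R) gam D :
  in_G g -> g 1 = 1 -> (0 < eps)%E -> 0 < gam -> 0 < D ->
  (forall z, 0 < z -> (z%:E < eps)%E -> z <= t -> g z <= D) ->
  (forall z, (z%:E < eps)%E -> t < z -> z <= t^-1 ->
     g z / z * (gam * (p * t ^+ 3) + z * p) <= D) ->
  (forall z, (z%:E < eps)%E -> t^-1 < z -> g z / z * (gam * (t^-1 - t)) <= D) ->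
  (((Phi t - q) / D)%:E <= C_E_g g eps gam)%E.
Proof.
move=> gG g1 eps0 gam0 D0 low mid high.
apply: (@le_trans _ _ (Deltan two_point_X / D)%:E).
  by rewrite lee_fin ler_wpM2r// invr_ge0 ltW.
apply: ratio_le_C_E_g => //; [exact: (Ln_X_gt0 var1)|] => z z0 zeps.
have [zt|tz] := leP z t.
  rewrite Mn_low// Ln_low// normr0 mulr0 add0r mulr1 divfK ?gt_eqF//.
  exact: low.
have [zt'|tz'] := leP z t^-1.
  rewrite Mn_mid// Ln_mid// ger0_norm; first exact: mid.
  by rewrite mulr_ge0 ?exprn_ge0// ltW.
rewrite Mn_high// Ln_high// mulr0 addr0 normrN ger0_norm ?subr_ge0//.
exact: high.
Qed.

(** Beyond [t^-1] the truncated variance vanishes, so that [0 <= D2] covers that range. *)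
Lemma two_point_C_R_g g (eps gam D1 D2 : R) :
  in_G g -> g 1 = 1 -> 0 < eps -> 0 < gam -> 0 < D1 + D2 ->
  gam * (g eps / eps) * (if eps <= t then 0 else if eps <= t^-1 then p * t ^+ 3
                         else t^-1 - t) <= D1 ->
  (forall z, 0 < z -> z < eps -> z <= t -> g z <= D2) ->
  (forall z, z < eps -> t < z -> z <= t^-1 -> g z * p <= D2) ->
  0 <= D2 ->
  (((Phi t - q) / (D1 + D2))%:E <= C_R_g g eps gam)%E.
Proof.
move=> gG g1 eps0 gam0 D0 HD1 low mid D20.
apply: (@le_trans _ _ (Deltan two_point_X / (D1 + D2))%:E).
  by rewrite lee_fin ler_wpM2r// invr_ge0 ltW.
apply: ratio_le_C_R_g => //; [exact: (Ln_X_gt0 var1)| |].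
  apply: le_trans HD1; apply: ler_wpM2l.
    case: gG => _ [_ [g_gt0 _]].
    by rewrite mulr_ge0 ?divr_ge0// ltW// g_gt0.
  have [zt|tz] := leP eps t; first by rewrite Mn_low// normr0.
  have [zt'|tz'] := leP eps t^-1.
    by rewrite Mn_mid// ger0_norm// mulr_ge0 ?exprn_ge0// ltW.
  by rewrite Mn_high// normrN ger0_norm ?subr_ge0.
move=> z z0 zeps; have [zt|tz] := leP z t; first by rewrite Ln_low// mulr1 low.
have [zt'|tz'] := leP z t^-1; first by rewrite Ln_mid// mid.
by rewrite Ln_high// mulr0.
Qed.

End two_point.

(** * Symmetrised lattice summands *)

(* Here L is L_n(z), and a, ..., e are the indicators of z not exceeding the
   successive absolute values 20, 25, 30, 35 (in units of 1/66) and 100. *)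
Lemma lattice_envelope (R : realType) (z L a b c d e : R) : 0 < z -> 0 <= L ->
  a <= 1 -> b <= 1 -> c <= 1 -> d <= 1 -> e <= 1 ->
  (10 / 33 < z -> a = 0) -> (25 / 66 < z -> b = 0) ->
  (5 / 11 < z -> c = 0) -> (35 / 66 < z -> d = 0) ->
  11979 * L = 1400 * a + 1875 * b + 2250 * c + 2450 * d + 4004 * e ->
  Num.min z 1 * L <= 3346 / 10000.
Proof.
move=> z0 L0 a1 b1 c1 d1 e1 a0 b0 c0 d0.
(* Between consecutive jumps [L] is constant and the product is largest at the right end. The bound
   0.3346 lies just above the largest such value, [25 / 66 * (10579 / 11979)]. *)
have step (k l : R) : z <= k -> k * l <= 3346 / 10000 -> L <= l ->
    Num.min z 1 * L <= 3346 / 10000.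
  move=> zk kl Ll; apply: le_trans kl; apply: ler_pM => //.
    by rewrite le_min ltW//= ler01.
  by apply: le_trans zk; rewrite ge_min lexx.
(* Past the lattice values only the variance 4004/11979 = 364/1089 of the large jump is left, and
   the cap of the weight at 1 applies. *)
have far : L <= 4004 / 11979 -> Num.min z 1 * L <= 3346 / 10000.
  move=> Ll; apply: (@le_trans _ _ L); first by rewrite ler_piMl// ge_min lexx orbT.
  by apply: le_trans Ll _; clear; lra.
have [z1|/a0 ->] := leP z (10 / 33).
  have num : 10 / 33 * 1 <= 3346 / 10000 :> R by clear; lra.
  by move=> LE; apply: step z1 num _; move: LE; clear -a1 b1 c1 d1 e1; lra.
have [z2|/b0 ->] := leP z (25 / 66).
  have num : 25 / 66 * (10579 / 11979) <= 3346 / 10000 :> R by clear; lra.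
  by move=> LE; apply: step z2 num _; move: LE; clear -b1 c1 d1 e1; lra.
have [z3|/c0 ->] := leP z (5 / 11).
  have num : 5 / 11 * (8704 / 11979) <= 3346 / 10000 :> R by clear; lra.
  by move=> LE; apply: step z3 num _; move: LE; clear -c1 d1 e1; lra.
have [z4|/d0 ->] := leP z (35 / 66).
  have num : 35 / 66 * (6454 / 11979) <= 3346 / 10000 :> R by clear; lra.
  by move=> LE; apply: step z4 num _; move: LE; clear -d1 e1; lra.
by move=> LE; apply: far; move: LE; clear -e1; lra.
Qed.

Section symmetrised_lattice.
Variable R : realType.

(** [v] is the variance that the four lattice summands leave to reach 1, and [eta] the probability
    with which a jump of size 100 carries it. *)
Let v : R := 364 / 1089.
Let eta : R := v / 100 ^+ 2.

(** The two-point laws are padded with a value of weight 0 to match the three values of the last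
    summand. *)
Definition lattice_weights : seq (seq R) :=
  [:: [:: 7 / 11; 4 / 11; 0]; [:: 7 / 11; 4 / 11; 0];
      [:: 6 / 11; 5 / 11; 0]; [:: 6 / 11; 5 / 11; 0];
      [:: eta / 2; eta / 2; 1 - eta]].

Definition lattice_values : seq (seq R) :=
  [:: [:: 10 / 33; - (35 / 66); 0]; [:: - (10 / 33); 35 / 66; 0];
      [:: 25 / 66; - (5 / 11); 0]; [:: - (25 / 66); 5 / 11; 0];
      [:: 100; - 100; 0]].

Definition lattice_weight (i : 'I_5) (j : 'I_3) : R := nth 0 (nth [::] lattice_weights i) j.

Let lattice_weight_ge0 i j : 0 <= lattice_weight i j.
Proof.
rewrite /lattice_weight /lattice_weights /eta /v.
by case: i => [[|[|[|[|[|//]]]]] ?]; case: j => [[|[|[|//]]] ?] /=; lra.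
Qed.

Let lattice_weight_sum i : \sum_j lattice_weight i j = 1.
Proof.
rewrite !big_ord_recl big_ord0 /lattice_weight.
by case: i => [[|[|[|[|[|//]]]]] ?] /=; lra.
Qed.

Definition lattice_law i := Law (lattice_weight_ge0 i) (lattice_weight_sum i).

Definition lattice_value (i : 'I_5) (j : 'I_3) : R := nth 0 (nth [::] lattice_values i) j.

Definition lattice_X := X lattice_law lattice_value.

Let mean0 i : \sum_j lattice_law i j * lattice_value i j = 0.
Proof.
rewrite !big_ord_recl big_ord0 /= /lattice_weight /lattice_value.
by case: i => [[|[|[|[|[|//]]]]] ?] /=; lra.
Qed.

Let var1 : \sum_i \sum_j lattice_law i j * lattice_value i j ^+ 2 = 1.
Proof.
by rewrite !big_ord_recl !big_ord0 /= /lattice_weight /lattice_value /= /eta /v; lra.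
Qed.

Let adm : admissible lattice_X. Proof. exact: admissible_X. Qed.
Let B1 : Bn lattice_X = 1. Proof. exact: Bn_X. Qed.

(* The summands come in pairs X, -X (the last one being symmetric itself), so
   that the truncated third moments cancel at every level. *)
Let Mn0 z : Mn lattice_X z = 0.
Proof.
rewrite Mn_X// !big_ord_recl !big_ord0 /= /lattice_weight /lattice_value /=.
rewrite !normrN.
by do ! case: ifP => _; lra.
Qed.

Let LnE z : 11979 * Ln lattice_X z =
  1400 * (z <= 10 / 33)%R%:R + 1875 * (z <= 25 / 66)%R%:R + 2250 * (z <= 5 / 11)%R%:R
  + 2450 * (z <= 35 / 66)%R%:R + 4004 * (z <= 100)%R%:R.
Proof.
rewrite Ln_X// !big_ord_recl !big_ord0 /= /lattice_weight /lattice_value /=.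
rewrite !normrN !ger0_norm; try lra.
have ifE (b : bool) (y : R) : (if b then y else 0) = y * b%:R.
  by case: b; rewrite /= ?mulr1 ?mulr0.
rewrite /eta /v !ifE; set i1 := (z <= 10 / 33)%R%:R; set i2 := (z <= 25 / 66)%R%:R.
set i3 := (z <= 5 / 11)%R%:R; set i4 := (z <= 35 / 66)%R%:R.
set i5 := (z <= 100)%R%:R; set i6 := (z <= 0)%R%:R.
by move: i1 i2 i3 i4 i5 i6 => *; lra.
Qed.

Let Ln_bound z : 0 < z -> Num.min z 1 * Ln lattice_X z <= 3346 / 10000.
Proof.
move=> z0; have le1 (b : bool) : b%:R <= 1 :> R by case: b; rewrite /= ?lexx ?ler01.
have eq0 (c : R) : c < z -> (z <= c)%R%:R = 0 :> R by move=> /lt_geF ->.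
apply: (lattice_envelope z0 (Ln_X_ge0 var1 z) (le1 _) (le1 _) (le1 _) (le1 _) (le1 _)
  (@eq0 _) (@eq0 _) (@eq0 _) (@eq0 _) (LnE z)).
Qed.

(** In units of 5/66, since 4 + 7 = 5 + 6 = 11, each of the two differences is 0, 11 or -11. Without
    the large jump (last index 2) they cancel in six ways: four with both zero, two with opposite
    signs. *)
Definition zero_outcomes : seq (outcome 5 2) :=
  [seq [ffun i : 'I_5 => inord (nth 0%N s i)] |
     s <- [:: [:: 0; 0; 0; 0; 2]; [:: 1; 1; 1; 1; 2]; [:: 1; 1; 0; 0; 2];
              [:: 1; 0; 0; 1; 2]; [:: 0; 1; 1; 0; 2]; [:: 0; 0; 1; 1; 2]]%N].

Let uniq_zero_outcomes : uniq zero_outcomes.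
Proof.
(* Lists of natural numbers can be compared by computation. *)
apply: (@map_uniq _ _ (fun w : outcome 5 2 => [seq val (w i) | i <- enum 'I_5])).
rewrite /zero_outcomes -map_comp /=.
by rewrite !enum_ordSl !enum_ord0 /= !ffunE /= !inordK.
Qed.

Let sum_zero_outcomes (f : outcome 5 2 -> R) : (forall w, 0 <= f w) ->
  \sum_(w <- zero_outcomes) f w <= \sum_w f w.
Proof.
move=> f0; rewrite (big_uniq _ uniq_zero_outcomes) [leRHS](bigID (mem zero_outcomes)) /=.
by rewrite lerDl sumr_ge0.
Qed.

Let prob_zero : 5645 / 14641 * (1 - eta) <=
  fine (product_law lattice_law [set w | Sn lattice_X w / Bn lattice_X = 0]).
Proof.
rewrite product_lawE /=.
(* Discarding the other outcomes is harmless for a lower bound. The six kept have total lattice mass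
   ((49 + 16)(36 + 25) + 2 * 28 * 30) / 121^2 = 5645/14641. *)
apply: le_trans (sum_zero_outcomes _); last first.
  by move=> w; rewrite mulr_ge0 ?point_mass_ge0// indicE.
have zero_mem (w : outcome 5 2) : \sum_i lattice_value i (w i) = 0 ->
    \1_[set w | Sn lattice_X w / Bn lattice_X = 0] w = 1 :> R.
  by move=> S0; rewrite indicE mem_set//= B1 divr1.
rewrite /zero_outcomes big_map !big_cons big_nil.
rewrite !zero_mem /point_mass.
all: rewrite !big_ord_recl !big_ord0 /= /lattice_weight /lattice_value !ffunE /= ?inordK//=.
all: lra.
Qed.

(** Half of the atom at 0 bounds the distance from below by about 0.19277, and the fraction is at
    most 0.3346 by [Ln_bound], as [Mn] vanishes. *)
Lemma C_E_min1_ge (eps : \bar R) (gam : R) : (0 < eps)%E -> 0 < gam ->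
  ((576 / 1000 : R)%:E <= C_E_g (fun z : R => Num.min z 1)%R eps gam)%E.
Proof.
have D0 : 0 < 3346 / 10000 :> R by rewrite divr_gt0 ?ltr0n.
have dev : 576 / 1000 * (3346 / 10000) <= Deltan lattice_X.
  apply: (@le_trans _ _ (5645 / 14641 * (1 - eta) / 2)).
    by rewrite /eta /v; lra.
  apply: le_trans (Deltan_ge_jump lattice_X (c := gauss_peak R) _).
    by apply: ler_wpM2r prob_zero; rewrite invr_ge0 ler0n.
  by move=> y y0; have := phi_diff_le y0; rewrite subr0.
move=> eps0 gam0.
apply: (@le_trans _ _ (Deltan lattice_X / (3346 / 10000))%:E).
  by rewrite lee_fin ler_pdivlMr.
have min11 : Num.min 1 1 = 1 :> R by rewrite minxx.
apply: (ratio_le_C_E_g adm B1 (@in_G_min1 R) min11 gam0 (Ln_X_gt0 var1) eps0 D0).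
move=> z z0 _; rewrite Mn0 normr0 mulr0 add0r mulrA divfK ?gt_eqF//.
exact: Ln_bound.
Qed.

End symmetrised_lattice.

(** * Lower bounds for the constants *)

Section parametrisation.
Variables (R : realType) (t : R).
Hypothesis t0 : 0 < t.

Let D_gt0 : 0 < 1 + t ^+ 2.
Proof. by rewrite ltr_pwDl// sqr_ge0. Qed.

(** The [p] for which [sqrt (q / p)] equals [t]; in terms of [t] all the radicals become rational
    functions. *)
Definition up_prob : R := (1 + t ^+ 2)^-1.

Lemma up_prob_gt0 : 0 < up_prob.
Proof. by rewrite invr_gt0. Qed.

Lemma onem_up_prob : 1 - up_prob = t ^+ 2 / (1 + t ^+ 2).
Proof. by rewrite /up_prob; field; rewrite gt_eqF. Qed.

Let onemE : 1 - up_prob = t ^+ 2 * up_prob. Proof. exact: onem_up_prob. Qed.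

Lemma sqrt_odds : Num.sqrt ((1 - up_prob) / up_prob) = t.
Proof. by rewrite onemE mulfK ?gt_eqF ?up_prob_gt0// sqrtr_sqr gtr0_norm. Qed.

Lemma sqrt_cube_div : Num.sqrt ((1 - up_prob) ^+ 3 / up_prob) = up_prob * t ^+ 3.
Proof.
have -> : (1 - up_prob) ^+ 3 / up_prob = (up_prob * t ^+ 3) ^+ 2.
  by rewrite onemE; field; rewrite gt_eqF ?up_prob_gt0.
by rewrite sqrtr_sqr gtr0_norm// mulr_gt0 ?up_prob_gt0// exprn_gt0.
Qed.

Lemma sqrt_prod : Num.sqrt (up_prob * (1 - up_prob)) = up_prob * t.
Proof.
have -> : up_prob * (1 - up_prob) = (up_prob * t) ^+ 2 by rewrite onemE; ring.
by rewrite sqrtr_sqr gtr0_norm// mulr_gt0 ?up_prob_gt0.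
Qed.

Lemma up_prob_gap : (up_prob - (1 - up_prob)) / (up_prob * t) = t^-1 - t.
Proof.
have p0 := up_prob_gt0; have -> : up_prob - (1 - up_prob) = up_prob * (1 - t ^+ 2).
  by rewrite onemE; ring.
by field; rewrite !gt_eqF.
Qed.

Lemma sqrt_up_cube_div : Num.sqrt (up_prob ^+ 3 / (1 - up_prob)) = up_prob / t.
Proof.
have -> : up_prob ^+ 3 / (1 - up_prob) = (up_prob / t) ^+ 2.
  by rewrite onemE; field; rewrite !gt_eqF ?up_prob_gt0.
by rewrite sqrtr_sqr gtr0_norm// divr_gt0 ?up_prob_gt0.
Qed.

Lemma Delta1_up_prob : Delta1 up_prob = Phi t - t ^+ 2 / (1 + t ^+ 2).
Proof. by rewrite /Delta1 sqrt_odds onem_up_prob. Qed.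

Lemma Delta1_profile :
  Delta1 up_prob / (Num.sqrt ((1 - up_prob) ^+ 3 / up_prob) + up_prob) = profile t.
Proof.
have D3 : 1 + t ^+ 3 != 0 by rewrite gt_eqF// ltr_pwDl// exprn_ge0// ltW.
rewrite sqrt_cube_div Delta1_up_prob /profile /up_prob.
by field; rewrite D3 !gt_eqF// addr_gt0 ?exprn_gt0.
Qed.

(** The case distinctions of the bounds in [p] are the positions of [eps] relative to the jumps: [t]
    here, [t^-1] in the next lemma. *)
Lemma up_prob_le_threshold (e : R) : 0 < e -> (up_prob <= 1 / (e ^+ 2 + 1)) = (e <= t).
Proof.
move=> e0; rewrite div1r lef_pV2 ?posrE// ?addr_gt0 ?exprn_gt0//.
by rewrite addrC lerD2l ler_pXn2r// nnegrE ltW.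
Qed.

Lemma threshold_le_up_prob (e : R) : 0 < e ->
  (e ^+ 2 / (e ^+ 2 + 1) <= up_prob) = (e <= t^-1).
Proof.
move=> e0; have e2 : 0 < e ^+ 2 by rewrite exprn_gt0.
rewrite ler_pdivrMr ?addr_gt0// mulrC ler_pdivlMr//.
rewrite mulrDr mulr1 lerD2l -exprMn -{1}(expr1n R 2) ler_pXn2r
  ?nnegrE ?mulr_ge0 ?(ltW e0) ?(ltW t0)//.
by rewrite -[t^-1]div1r ler_pdivlMr.
Qed.

End parametrisation.

Lemma half_one_up_prob (R : realType) (p : R) : 2^-1 < p < 1 ->
  exists2 t, 0 < t < 1 & p = up_prob t.
Proof.
move=> /andP[p_half p1]; have p0 : 0 < p by lra.
have odds0 : 0 < (1 - p) / p by rewrite divr_gt0// subr_gt0.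
exists (Num.sqrt ((1 - p) / p)).
  rewrite sqrtr_gt0 odds0/= -[ltRHS]sqrtr1 ltr_sqrt//.
  by rewrite ltr_pdivrMr// mul1r; lra.
rewrite /up_prob sqr_sqrtr ?(ltW odds0)//.
by field; rewrite gt_eqF//=; apply/eqP; lra.
Qed.

Lemma up_prob_half_one (R : realType) (t : R) : 0 < t < 1 -> 2^-1 < up_prob t < 1.
Proof.
move=> /andP[t0 t1]; have t2 : 0 < t ^+ 2 by rewrite exprn_gt0.
rewrite invf_lt1 ?addr_gt0// ltrDl t2 andbT ltf_pV2 ?posrE ?addr_gt0//.
rewrite -[ltRHS]/(1 + 1) ltrD2l expr_lt1// ltW//.
Qed.

Lemma up_prob_bounds (R : realType) (t : R) : 39 / 121 <= t <= 69 / 214 ->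
  (9058 / 10000 : R) <= up_prob t < 9059 / 10000.
Proof.
move=> /andP[lo hi]; have t0 : 0 <= t by move: lo; clear; lra.
have a0 : 0 <= 39 / 121 :> R by clear; lra.
have := ler_pM a0 a0 lo lo; have := ler_pM t0 t0 hi hi; rewrite -[t * t]expr2.
rewrite /up_prob -[(1 + t ^+ 2)^-1]div1r.
have D0 : 0 < 1 + t ^+ 2 by rewrite ltr_pwDl// sqr_ge0.
rewrite ler_pdivlMr// ltr_pdivrMr//.
by move: (t ^+ 2); clear => x hi lo; apply/andP; split; move: hi lo; clear; lra.
Qed.

(** Multiplied by [1 + t ^+ 2] this becomes [t ^+ 3 + t <= t ^+ 3 + 1]. It removes the maximum from
    the denominator when [gam = 1]. *)
Lemma le_denominator (R : realType) (t : R) : 0 < t < 1 ->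
  t <= up_prob t * t ^+ 3 + up_prob t.
Proof.
move=> /andP[t0 t1]; have D0 : 0 < 1 + t ^+ 2 by rewrite addr_gt0 ?exprn_gt0.
rewrite -(ler_pM2l D0) /up_prob.
have -> : (1 + t ^+ 2) * ((1 + t ^+ 2)^-1 * t ^+ 3 + (1 + t ^+ 2)^-1) = t ^+ 3 + 1.
  by field; rewrite gt_eqF.
rewrite (_ : _ * t = t ^+ 3 + t); last by ring.
by rewrite lerD2l ltW.
Qed.

Lemma sup_half_le (R : realType) (K : R -> R) (C : \bar R) :
  (forall t, 0 < t < 1 -> ((K (up_prob t))%:E <= C)%E) -> (sup_half K <= C)%E.
Proof.
move=> KC; apply: ge_ereal_sup => _ [p p_range <-].
by have [t t_range ->] := half_one_up_prob p_range; exact: KC.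
Qed.

(** * Bounds for each constant at a fixed parameter *)

Section lower_bounds.
Variable R : realType.
Implicit Types t eps gam : R.

Let min11 : Num.min 1 1 = 1 :> R. Proof. exact: minxx. Qed.

(** The case [t = 1], a fair sign: the middle range of [z] is empty and the third moments vanish. *)
Lemma symmetric_A_E eps gam : 0 < eps -> 0 < gam ->
  (((Phi 1 - 2^-1) / Num.min 1 eps)%:E <= A_E eps%:E gam)%E.
Proof.
move=> e0 gam0; have m0 : 0 < Num.min 1 eps by rewrite lt_min ltr01.
have -> : 2^-1 = 1 ^+ 2 / (1 + 1 ^+ 2) :> R by rewrite expr1n div1r.
apply: (two_point_C_E_g (ltr01 : 0 < (1 : R)) (lexx 1) (@in_G_id R)) => //.
- by move=> z z0; rewrite lte_fin => /ltW ze z1; rewrite le_min z1.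
- by move=> z _ z1; rewrite invr1 leNgt z1.
- by move=> z _ _; rewrite invr1 subrr !mulr0 ltW.
Qed.

Lemma symmetric_A_R eps gam : 0 < eps -> 0 < gam ->
  (((Phi 1 - 2^-1) / Num.min 1 eps)%:E <= A_R eps gam)%E.
Proof.
move=> e0 gam0; have m0 : 0 < Num.min 1 eps by rewrite lt_min ltr01.
have -> : 2^-1 = 1 ^+ 2 / (1 + 1 ^+ 2) :> R by rewrite expr1n div1r.
rewrite -[Num.min 1 eps]add0r.
apply: (two_point_C_R_g (ltr01 : 0 < (1 : R)) (lexx 1) (@in_G_id R)) => //.
- by rewrite add0r.
- by rewrite invr1 subrr; case: (eps <= 1); rewrite mulr0.
- by move=> z z0 /ltW ze z1; rewrite le_min z1.
- by move=> z _ z1; rewrite invr1 leNgt z1.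
- exact: ltW.
Qed.

Section range.
Variable t : R.
Hypothesis t_range : 0 < t < 1.

Let t0 : 0 < t. Proof. by case/andP: t_range. Qed.
Let t1 : t <= 1. Proof. by case/andP: t_range => _ /ltW. Qed.
Let inv_gt1 : 1 < t^-1. Proof. by case/andP: t_range => _; rewrite invf_gt1. Qed.
Let p_gt0 : 0 < up_prob t. Proof. exact: up_prob_gt0. Qed.
Let pt3_gt0 : 0 < up_prob t * t ^+ 3. Proof. by rewrite mulr_gt0 ?exprn_gt0. Qed.

Let E_ge := two_point_C_E_g t0 t1.
Let R_ge := two_point_C_R_g t0 t1.

Let gap_ge0 : 0 <= t^-1 - t.
Proof. by rewrite subr_ge0 (le_trans t1)// ltW. Qed.

(** Multiplied by [1 + t ^+ 2] this becomes [gam * (1 - t ^+ 4) <= gam * t ^+ 3 + 1]. So for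
    [gam <= 1] the range beyond [t^-1], where the capped weight gives [1 / z <= t], does not
    dominate. *)
Let gap_bound gam : 0 < gam -> gam <= 1 ->
  t * (gam * (t^-1 - t)) <= gam * (up_prob t * t ^+ 3) + up_prob t.
Proof.
move=> gam0 gam1; have D0 : 0 < 1 + t ^+ 2 by rewrite addr_gt0 ?exprn_gt0.
rewrite -(ler_pM2l D0) /up_prob.
have -> : (1 + t ^+ 2) * (t * (gam * (t^-1 - t))) = gam * (1 - t ^+ 4).
  by field; rewrite gt_eqF.
have -> : (1 + t ^+ 2) * (gam * ((1 + t ^+ 2)^-1 * t ^+ 3) + (1 + t ^+ 2)^-1)
    = gam * t ^+ 3 + 1 by field; rewrite gt_eqF.
have t4 : 0 <= gam * t ^+ 4 by rewrite mulr_ge0 ?exprn_ge0 ?ltW.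
have t3 : 0 <= gam * t ^+ 3 by rewrite mulr_ge0 ?exprn_ge0 ?ltW.
lra.
Qed.

(** The weight [id] is enough: [z < eps <= 1] never passes the jump at [t^-1 > 1]. *)
Lemma K_E0_small eps gam : 0 < eps -> 0 < gam -> eps <= 1 ->
  ((K_E0 eps gam (up_prob t))%:E <= C_E eps%:E gam)%E.
Proof.
move=> e0 gam0 e1; apply: le_trans (A_E_le_C_E _ _).
rewrite /K_E0 e1 sqrt_odds// sqrt_cube_div// Delta1_up_prob// up_prob_le_threshold//.
have [et|te] := leP eps t; apply: E_ge => //; try exact: in_G_id.
- by move=> z _; rewrite lte_fin => /ltW.
- by move=> z + tz; rewrite lte_fin => /(lt_trans tz); rewrite ltNge et.
- move=> z + tz; rewrite lte_fin => /(lt_trans tz) te.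
  by have := lt_le_trans (lt_trans inv_gt1 te) e1; rewrite ltxx.
- by rewrite lt_max t0.
- by move=> z _ _ zt; rewrite le_max zt.
- move=> z + tz _; rewrite lte_fin => /ltW ze.
  rewrite divff ?gt_eqF ?(lt_trans t0)// mul1r le_max lerD2l ler_pM2r// ze.
  by rewrite orbT.
- move=> z + tz; rewrite lte_fin => /(lt_trans tz) te'.
  by have := lt_le_trans (lt_trans inv_gt1 te') e1; rewrite ltxx.
Qed.

(** The level is an extended real so that the particular cases 1 and infinity are both covered. *)
Lemma min1_C_E (eps : \bar R) gam : (0 < eps)%E -> 0 < gam -> gam <= 1 ->
  ((Delta1 (up_prob t) / Num.max t (gam * (up_prob t * t ^+ 3) + up_prob t))%:E
     <= C_E eps gam)%E.
Proof.
move=> e0 gam0 gam1; apply: le_trans (C_E_g_le_C_E _ _ (@in_G_min1 R)).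
rewrite Delta1_up_prob//; apply: E_ge => //; first exact: in_G_min1.
- by rewrite lt_max t0.
- by move=> z _ _ zt; rewrite le_max ge_min zt.
- move=> z _ tz _; have z0 := lt_trans t0 tz.
  rewrite le_max; apply/orP; right; rewrite mulrDr; apply: lerD.
    apply: ler_piMl; first exact: mulr_ge0 (ltW gam0) (ltW pt3_gt0).
    by rewrite ler_pdivrMr// mul1r ge_min lexx.
  rewrite mulrA divfK ?gt_eqF//; apply: ler_piMl; first exact: ltW p_gt0.
  by rewrite ge_min lexx orbT.
- move=> z _ tz; rewrite le_max; apply/orP; right.
  apply: le_trans (gap_bound gam0 gam1); apply: ler_wpM2r.
    by rewrite mulr_ge0// ltW.
  rewrite min_r; last by rewrite ltW// (lt_trans inv_gt1).
  by rewrite div1r -[leRHS]invrK lef_pV2 ?posrE ?invr_gt0 ?(ltW tz)//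
    (lt_trans ltr01)// (lt_trans inv_gt1).
Qed.

(** The quotient is at most the one with the second entry alone and [gam = 1], which is
    [profile t]. *)
Lemma K_E0_large_gam gam : 1 <= gam ->
  Delta1 (up_prob t) / Num.max t (gam * (up_prob t * t ^+ 3) + up_prob t)
    <= 576 / 1000.
Proof.
move=> gam1; apply: le_trans (profile_le t0); rewrite -(Delta1_profile t0).
have Delta1_ge0 : 0 <= Delta1 (up_prob t).
  rewrite Delta1_up_prob// subr_ge0; apply: le_trans (Phi_ge_half (ltW t0)).
  have t2 : t ^+ 2 <= 1 by rewrite expr_le1// ltW.
  by rewrite ler_pdivrMr ?addr_gt0 ?exprn_gt0//; lra.
apply: ler_wpM2l => //; rewrite sqrt_cube_div// lef_pV2 ?posrE ?lt_max ?t0//.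
  rewrite le_max; apply/orP; right; rewrite lerD2r.
  by rewrite ler_peMl// ltW.
by rewrite addr_gt0.
Qed.

(** For [eps > 1] the two-point law serves [gam <= 1] and the lattice example serves [gam > 1]. *)
Lemma K_E0_le_C_E eps gam : 0 < eps -> 0 < gam ->
  ((K_E0 eps gam (up_prob t))%:E <= C_E eps%:E gam)%E.
Proof.
move=> e0 gam0; have [e1|e1] := leP eps 1; first exact: K_E0_small.
rewrite /K_E0 (lt_geF e1) sqrt_odds// sqrt_cube_div//.
have [gam1|gam1] := leP gam 1; first exact: min1_C_E.
apply: (@le_trans _ _ (576 / 1000 : R)%:E); last first.
  by apply: le_trans (C_E_g_le_C_E _ _ (@in_G_min1 R)); exact: C_E_min1_ge.
by rewrite lee_fin K_E0_large_gam// ltW.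
Qed.

(** Unlike in [L_E], the third moment enters only at [z = eps], so that the two-point law serves
    every [gam]; the weight is [id] for [eps <= 1] and the capped one beyond. *)
Lemma K_R0_le_C_R eps gam : 0 < eps -> 0 < gam ->
  ((K_R0 eps gam (up_prob t))%:E <= C_R eps gam)%E.
Proof.
move=> e0 gam0; rewrite /K_R0 sqrt_odds// sqrt_cube_div// Delta1_up_prob//.
rewrite up_prob_le_threshold// threshold_le_up_prob//.
have [e1|e1] := leP eps 1.
  apply: le_trans (A_R_le_C_R _ _).
  have e_inv : eps <= t^-1 by rewrite (le_trans e1)// ltW.
  have [et|te] := leP eps t.
    rewrite -[X in _ / X]add0r; apply: R_ge => //; rewrite ?add0r//.
    - exact: in_G_id.
    - by rewrite et mulr0.
    - by move=> z _ /ltW.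
    - by move=> z ze tz; have := lt_le_trans (lt_trans tz ze) et; rewrite ltxx.
    - exact: ltW.
  apply: R_ge => //; first exact: in_G_id.
  - by rewrite ltr_wpDl ?lt_max ?t0// mulr_ge0// ltW.
  - by rewrite (lt_geF te) e_inv divff ?gt_eqF// mulr1.
  - by move=> z _ _ zt; rewrite le_max zt.
  - by move=> z /ltW ze _ _; rewrite le_max ler_pM2r// ze orbT.
  - by rewrite le_max ltW.
apply: le_trans (C_R_g_le_C_R _ _ (@in_G_min1 R)).
have te : t < eps by rewrite (le_lt_trans t1).
have low (z : R) : 0 < z -> z < eps -> z <= t -> Num.min z 1 <= Num.max t (up_prob t).
  by move=> _ _ zt; rewrite le_max ge_min zt.
have mid (z : R) : z < eps -> t < z -> z <= t^-1 ->
    Num.min z 1 * up_prob t <= Num.max t (up_prob t).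
  move=> _ _ _; rewrite le_max; apply/orP; right.
  by rewrite ler_piMl ?(ltW p_gt0)// ge_min lexx orbT.
have D2 : 0 < Num.max t (up_prob t) by rewrite lt_max t0.
have min_e : Num.min eps 1 = 1 by rewrite min_r// ltW.
have [e_inv|inv_e] := leP eps t^-1.
  apply: R_ge => //; [exact: in_G_min1|..|exact: ltW].
    by rewrite ltr_wpDl// mulr_ge0// ?divr_ge0 ?(ltW pt3_gt0) ?(ltW gam0) ?(ltW e0).
  by rewrite (lt_geF te) e_inv min_e mul1r.
rewrite sqrt_prod// -mulf_div up_prob_gap//.
apply: R_ge => //; [exact: in_G_min1|..|exact: ltW].
  by rewrite ltr_wpDl// mulr_ge0// divr_ge0// ltW.
by rewrite (lt_geF te) (lt_geF inv_e) min_e mul1r.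
Qed.

(* Here D is the third denominator of K_{E,*} divided by sqrt (p q). *)
Lemma A_E_far (eps : \bar R) gam : (0 < eps)%E -> 0 < gam ->
  ((Delta1 (up_prob t) * (up_prob t * t)
    / Num.max (1 - up_prob t) (Num.max (gam * (1 - up_prob t) ^+ 2 + up_prob t ^+ 2)
                                       (gam * (up_prob t - (1 - up_prob t)))))%:E
     <= A_E eps gam)%E.
Proof.
move=> e0 gam0; set D := Num.max _ _.
have pt0 : 0 < up_prob t * t by rewrite mulr_gt0.
have q0 : 0 < 1 - up_prob t by rewrite onem_up_prob// divr_gt0 ?addr_gt0 ?exprn_gt0.
have D0 : 0 < D by rewrite lt_max q0.
have qE : 1 - up_prob t = t * (up_prob t * t) by rewrite onem_up_prob// /up_prob; ring.
rewrite -[_ * _ / D]mulrA -[_ * t / D]invf_div Delta1_up_prob//.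
(* Here [up_prob t * t] is [sqrt (p q)], so that multiplying by it turns each range into one entry
   of [D]. *)
have leD a : a * (up_prob t * t) <= D -> a <= D / (up_prob t * t).
  by rewrite ler_pdivlMr.
apply: E_ge => //; first exact: in_G_id.
- by rewrite divr_gt0.
- move=> z _ _ zt; apply: (le_trans zt); apply: leD.
  by rewrite -qE le_max lexx.
- move=> z _ tz zt; rewrite divff ?gt_eqF ?(lt_trans t0)// mul1r.
  apply: (@le_trans _ _ (gam * (up_prob t * t ^+ 3) + t^-1 * up_prob t)).
    by rewrite lerD2l ler_pM2r.
  apply: leD; rewrite !le_max; apply/orP; right; apply/orP; left.
  rewrite le_eqVlt; apply/orP; left; apply/eqP; rewrite qE.
  by field; rewrite gt_eqF.
- move=> z _ tz; rewrite divff ?gt_eqF ?(lt_trans _ tz) ?invr_gt0// mul1r.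
  apply: leD; rewrite -(up_prob_gap t0) -mulrA divfK ?gt_eqF//.
  by rewrite !le_max lexx !orbT.
Qed.

Lemma K_Estar_le_A_E eps gam : 1 < eps -> 0 < gam ->
  ((K_Estar eps gam (up_prob t))%:E <= A_E eps%:E gam)%E.
Proof.
move=> e1 gam0; have e0 : 0 < eps by rewrite (lt_trans ltr01).
rewrite /K_Estar sqrt_odds// sqrt_cube_div// sqrt_prod// Delta1_up_prob//.
rewrite threshold_le_up_prob//; have [e_inv|inv_e] := leP eps t^-1.
  apply: E_ge => //; first exact: in_G_id.
  - by rewrite lt_max t0.
  - by move=> z _ _ zt; rewrite le_max zt.
  - move=> z + tz _; rewrite lte_fin => /ltW ze.
    rewrite divff ?gt_eqF ?(lt_trans t0)// mul1r le_max lerD2l ler_pM2r// ze.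
    by rewrite orbT.
  - by move=> z + tz; rewrite lte_fin => /(lt_trans tz); rewrite ltNge e_inv.
by rewrite -Delta1_up_prob//; apply: A_E_far; rewrite ?lte_fin.
Qed.

Lemma K_Rstar_le_A_R eps gam : 1 < eps -> 0 < gam ->
  ((K_Rstar eps gam (up_prob t))%:E <= A_R eps gam)%E.
Proof.
move=> e1 gam0; have e0 : 0 < eps by rewrite (lt_trans ltr01).
have te : t < eps by rewrite (le_lt_trans t1).
rewrite /K_Rstar sqrt_odds// sqrt_cube_div// sqrt_prod// sqrt_up_cube_div//.
rewrite Delta1_up_prob// threshold_le_up_prob//.
have [e_inv|inv_e] := leP eps t^-1.
  apply: R_ge => //; first exact: in_G_id.
  - by rewrite ltr_wpDl ?lt_max ?t0// mulr_ge0// ltW.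
  - by rewrite (lt_geF te) e_inv divff ?gt_eqF// mulr1.
  - by move=> z _ _ zt; rewrite le_max zt.
  - by move=> z /ltW ze _ _; rewrite le_max ler_pM2r// ze orbT.
  - by rewrite le_max ltW.
rewrite -mulrA up_prob_gap//; apply: R_ge => //; first exact: in_G_id.
- by rewrite ltr_wpDl ?lt_max ?t0// mulr_ge0// ltW.
- by rewrite (lt_geF te) (lt_geF inv_e) divff ?gt_eqF// mulr1.
- by move=> z _ _ zt; rewrite le_max zt.
- by move=> z _ _ zt; rewrite le_max [z * _]mulrC ler_pM2l// zt orbT.
- by rewrite le_max ltW.
Qed.

End range.

End lower_bounds.

(** * Explicit numerical values and the final assembly *)

Lemma s1_le_A_E (R : realType) (t : R) : 0 < t < 1 ->
  ((Delta1 (up_prob t) * Num.sqrt (up_prob t * (1 - up_prob t))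
    / ((1 - up_prob t) ^+ 2 + up_prob t ^+ 2))%:E <= A_E +oo 1)%E.
Proof.
move=> t_range; have /andP[t0 _] := t_range.
have /andP[p_half p1] := up_prob_half_one t_range.
have := A_E_far t_range (ltry 0 : (0 < +oo :> \bar R)%E) ltr01.
(* With [p > q] and [p + q = 1], both [p - q = p^2 - q^2] and [q = q^2 + p q] are at most
   [q^2 + p^2]. *)
rewrite sqrt_prod// !mul1r [X in _ / Num.max _ X]max_l; last first.
  by move: (up_prob t) p_half p1 => p *; nra.
by rewrite max_r//; move: (up_prob t) p_half p1 => p *; nra.
Qed.

(** At [t = 4 / 5] all quantities except [Phi t] are rational, and the value is about 0.37035. *)
Lemma s1_lower (R : realType) : 3703 / 10000 <
  Delta1 (up_prob (4 / 5)) * Num.sqrt (up_prob (4 / 5) * (1 - up_prob (4 / 5)))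
    / ((1 - up_prob (4 / 5)) ^+ 2 + up_prob (4 / 5) ^+ 2) :> R.
Proof.
have t0 : 0 < 4 / 5 :> R by lra.
have pE : up_prob (4 / 5) = 25 / 41 :> R.
  by rewrite /up_prob (_ : 1 + _ = 41 / 25) ?invf_div//; lra.
rewrite sqrt_prod// Delta1_up_prob// -onem_up_prob// pE.
have -> : (1 - 25 / 41) ^+ 2 + (25 / 41) ^+ 2 = 881 / 1681 :> R by clear; lra.
rewrite ltr_pdivlMr; last by clear; lra.
have := @Phi_lower R (4 / 5) (ltW t0); have /andP[] := gauss_peak_bounds R.
by move: (gauss_peak R) (Phi _); clear => c H; lra.
Qed.

Theorem theorem3 (R : realType) :
  (* (i) *)
  (forall eps gam : R, 0 < eps -> 0 < gam ->
     let c := (Phi 1 - 2^-1) / Num.min 1 eps in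
     ((c%:E <= C_E eps%:E gam)%E /\ (c%:E <= C_R eps gam)%E /\
      (c%:E <= A_E eps%:E gam)%E /\ (c%:E <= A_R eps gam)%E) /\
     (3413 / 10000) / Num.min 1 eps < c) /\
  (* (ii) *)
  (forall eps gam : R, 0 < eps -> 0 < gam ->
     (sup_half (K_E0 eps gam) <= C_E eps%:E gam)%E /\
     (sup_half (K_R0 eps gam) <= C_R eps gam)%E /\
     (1 < eps ->
        (sup_half (K_Estar eps gam) <= A_E eps%:E gam)%E /\
        (sup_half (K_Rstar eps gam) <= A_R eps gam)%E)) /\
  (* particular cases *)
  (let s1 := sup_half (fun p : R => Delta1 p * Num.sqrt (p * (1 - p)) /
                                    ((1 - p) ^+ 2 + p ^+ 2)) in
   (s1 <= A_E +oo%E 1)%E /\ ((3703 / 10000 : R)%:E < s1)%E) /\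
  (let f := fun p : R => Delta1 p / (Num.sqrt ((1 - p) ^+ 3 / p) + p) in
   let s2 := sup_half f in
   (s2 <= C_E 1%:E 1)%E /\ (s2 <= C_R 1 1)%E /\ (s2 <= C_E +oo%E 1)%E /\
   ((5685 / 10000 : R)%:E < s2)%E /\
   exists p0 : R, 9058 / 10000 <= p0 < 9059 / 10000 /\ (f p0)%:E = s2).
Proof.
split=> [eps gam e0 gam0 c|].
  split.
    split; first exact: le_trans (symmetric_A_E e0 gam0) (A_E_le_C_E _ _).
    split; first exact: le_trans (symmetric_A_R e0 gam0) (A_R_le_C_R _ _).
    by split; [exact: symmetric_A_E|exact: symmetric_A_R].
  by rewrite /c ltr_pM2r ?Phi1_lower// invr_gt0 lt_min ltr01.
split=> [eps gam e0 gam0|].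
  split; first by apply: sup_half_le => t t_range; exact: K_E0_le_C_E.
  split; first by apply: sup_half_le => t t_range; exact: K_R0_le_C_R.
  move=> e1; split; apply: sup_half_le => t t_range; first exact: K_Estar_le_A_E.
  exact: K_Rstar_le_A_R.
split=> [s1|f s2].
  split; first by apply: sup_half_le => t t_range; exact: s1_le_A_E.
  have t_range : 0 < (4 / 5 : R) < 1 by apply/andP; split; lra.
  apply: lt_le_trans (_ : (_%:E <= s1)%E); first by rewrite lte_fin; exact: s1_lower.
  by apply: ereal_sup_ubound; exists (up_prob (4 / 5)) => //; exact: up_prob_half_one.
have [t0 t0_bounds t0_max] := profile_max R.
have t0_range : 0 < t0 < 1.
  by case/andP: t0_bounds => lo hi; apply/andP; split; lra.
have /andP[t0_gt0 t0_lt1] := t0_range.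
(* This resolves the maximum in the denominator of [K_R0]. *)
have t0_le_p : t0 <= up_prob t0.
  have /andP[p_half _] := up_prob_half_one t0_range.
  by apply: le_trans (ltW p_half); case/andP: t0_bounds => _; clear; lra.
have s2E : (f (up_prob t0))%:E = s2.
  apply/eqP; rewrite eq_le; apply/andP; split.
    by apply: ereal_sup_ubound; exists (up_prob t0) => //; exact: up_prob_half_one.
  apply: sup_half_le => t t_range; have /andP[t_gt0 _] := t_range.
  by rewrite lee_fin /f !Delta1_profile//; exact: t0_max.
have fE : f (up_prob t0) =
    Delta1 (up_prob t0) / (up_prob t0 * t0 ^+ 3 + up_prob t0).
  by rewrite /f sqrt_cube_div.
have pt3_gt0 : 0 < up_prob t0 * t0 ^+ 3 by rewrite mulr_gt0 ?up_prob_gt0 ?exprn_gt0.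
(* Since the supremum is attained at [up_prob t0], the two-point bound at [t0] alone is enough. *)
have s2_le_C_E (eps : \bar R) : (0 < eps)%E -> (s2 <= C_E eps 1)%E.
  move=> eps0; rewrite -s2E fE.
  have := min1_C_E t0_range eps0 ltr01 (lexx 1).
  by rewrite mul1r max_r ?le_denominator.
split; first by apply: s2_le_C_E; rewrite lte_fin.
split.
  (* At [eps = gam = 1] the first case of [K_R0] would require [1 <= t0]. *)
  have := K_R0_le_C_R t0_range ltr01 ltr01; rewrite -s2E fE /K_R0 lexx.
  rewrite up_prob_le_threshold// (lt_geF t0_lt1).
  by rewrite !mul1r sqrt_odds// sqrt_cube_div// max_r.
split; first by apply: s2_le_C_E; rewrite ltry.
split; last by exists (up_prob t0); split; first exact: up_prob_bounds.
rewrite -s2E lte_fin /f Delta1_profile//.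
apply: (lt_le_trans (profile_10_31 R)); apply: t0_max.
by clear; apply/andP; split; lra.
Qed.
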